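(* Suppose $G$ is a graph on $n$ vertices which can be constructed from $K_5-e$, $H_1$ or $H_2$ by a sequence of $1$-extensions and edge additions. Then $(G,p)$ is globally rigid on $\mathcal{Y}^p$ for all generic $p\in\mathbb{R}^{3n}$.
   Context: All graphs are finite and simple. $K_5-e$ is the complete graph on five vertices with one edge deleted. $H_1$ is the graph with vertices $v_1,\dots,v_6$ and the $11$ edges $v_1v_2,v_1v_4,v_1v_5,v_2v_4,v_2v_5,v_4v_5,v_2v_3,v_2v_6,v_3v_5,v_3v_6,v_5v_6$ (two copies of $K_4$ sharing exactly one edge). $H_2$ is the graph with vertices $v_1,\dots,v_7$ and the $13$ edges $v_1v_2,v_1v_4,v_1v_5,v_2v_4,v_2v_5,v_4v_5,v_3v_5,v_3v_6,v_3v_7,v_5v_6,v_5v_7,v_6v_7,v_2v_3$ (two copies of $K_4$ sharing exactly one vertex, plus one edge joining them). Edge addition adds a new edge between two non-adjacent vertices. A $1$-extension deletes an edge $v_av_b$ and adds a new vertex $v_0$ and three new edges $v_0v_a,v_0v_b,v_0v_c$ for some existing vertex $v_c$ distinct from $v_a,v_b$. For $G=(V,E)$ with $V=\{v_1,\dots,v_n\}$, a point $p\in\mathbb{R}^{3n}$ is identified with a map $p:V\to\mathbb{R}^3$, $p(v_i)=(x_i,y_i,z_i)$; it is generic if its $3n$ coordinates are algebraically independent over $\mathbb{Q}$. $\mathcal{Y}^p=\bigcup_{i}\mathcal{Y}_i$ is the family of concentric cylinders $\mathcal{Y}_i=\{(x,y,z)\in\mathbb{R}^3:x^2+y^2=r_i\}$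 with $r_i=x_i^2+y_i^2$. A framework $(G,q)$ on $\mathcal{Y}^p$ is a map $q:V\to\mathbb{R}^3$ with $q(v_i)\in\mathcal{Y}_i$ for all $i$. $(G,p)$ is globally rigid on $\mathcal{Y}^p$ if every framework $(G,q)$ on $\mathcal{Y}^p$ with $\|q(v_i)-q(v_j)\|=\|p(v_i)-p(v_j)\|$ for all $v_iv_j\in E$ satisfies $\|q(v_i)-q(v_j)\|=\|p(v_i)-p(v_j)\|$ for all $v_i,v_j\in V$. *)

(* Defs.v *)
From HB Require Import structures.
(* [mpoly] comes first so that its [symmetric] does not hide the one of ssrbool. *)
From mathcomp Require Import mpoly.
From mathcomp Require Import all_boot all_order all_algebra.
From mathcomp Require Import reals.

Set Implicit Arguments.
Unset Strict Implicit.
Unset Printing Implicit Defensive.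

Import Order.TTheory GRing.Theory Num.Theory.
Local Open Scope ring_scope.

Record sgraph := SGraph {
  vertex :> finType;
  adj : rel vertex;
  adj_sym : symmetric adj;
  adj_irr : irreflexive adj }.

Definition isomorphic (G H : sgraph) : Prop :=
  exists2 f : G -> H, bijective f & forall x y, adj (f x) (f y) = adj x y.

Section Operations.
Variables (G : sgraph) (a b c : G).

Definition add_edge_rel : rel G :=
  fun x y => adj x y || (x != y) && ([set x; y] == [set a; b]).

Fact add_edge_sym : symmetric add_edge_rel.
Proof. by move=> x y; rewrite /add_edge_rel adj_sym eq_sym setUC. Qed.

Fact add_edge_irr : irreflexive add_edge_rel.
Proof. by move=> x; rewrite /add_edge_rel adj_irr eqxx. Qed.

Definition add_edge := SGraph add_edge_sym add_edge_irr.

Definition delete_edge_rel : rel G :=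
  fun x y => adj x y && ([set x; y] != [set a; b]).

Fact delete_edge_sym : symmetric delete_edge_rel.
Proof. by move=> x y; rewrite /delete_edge_rel adj_sym setUC. Qed.

Fact delete_edge_irr : irreflexive delete_edge_rel.
Proof. by move=> x; rewrite /delete_edge_rel adj_irr. Qed.

Definition delete_edge := SGraph delete_edge_sym delete_edge_irr.

(* The new vertex v_0 is [None]. *)
Definition one_extension_rel : rel (option G) := fun x y =>
  match x, y with
  | Some x', Some y' => delete_edge_rel x' y'
  | Some z, None | None, Some z => z \in [set a; b; c]
  | None, None => false
  end.

Fact one_extension_sym : symmetric one_extension_rel.
Proof. by move=> [x|] [y|] //=; apply: delete_edge_sym. Qed.

Fact one_extension_irr : irreflexive one_extension_rel.
Proof. by move=> [x|] //=; apply: delete_edge_irr. Qed.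

Definition one_extension := SGraph one_extension_sym one_extension_irr.

End Operations.

Section BaseGraphs.
Variable n : nat.

Definition complete_rel : rel 'I_n := fun i j => i != j.

Fact complete_sym : symmetric complete_rel.
Proof. by move=> i j; rewrite /complete_rel eq_sym. Qed.

Fact complete_irr : irreflexive complete_rel.
Proof. by move=> i; rewrite /complete_rel eqxx. Qed.

Definition complete_graph := SGraph complete_sym complete_irr.

(* Vertices in the edge list [s] are numbered from 1: the pair (k, l) joins
   the ordinals of values k - 1 and l - 1. *)
Variable s : seq (nat * nat).

Definition list_rel : rel 'I_n := fun i j =>
  (i != j) && (((i.+1, j.+1) \in s) || ((j.+1, i.+1) \in s)).

Fact list_sym : symmetric list_rel.
Proof. by move=> i j; rewrite /list_rel eq_sym orbC. Qed.

Fact list_irr : irreflexive list_rel.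
Proof. by move=> i; rewrite /list_rel eqxx. Qed.

Definition list_graph := SGraph list_sym list_irr.

End BaseGraphs.

Definition K5_minus_edge : sgraph :=
  @delete_edge (complete_graph 5) (0 : 'I_5) (1 : 'I_5).

Definition H1 : sgraph := list_graph 6
  [:: (1, 2); (1, 4); (1, 5); (2, 4); (2, 5); (4, 5);
      (2, 3); (2, 6); (3, 5); (3, 6); (5, 6)]%N.

Definition H2 : sgraph := list_graph 7
  [:: (1, 2); (1, 4); (1, 5); (2, 4); (2, 5); (4, 5);
      (3, 5); (3, 6); (3, 7); (5, 6); (5, 7); (6, 7); (2, 3)]%N.

(* [constructible_iso] makes the class independent of vertex names; in
   particular it does not matter that one_extension uses [option G]. *)
Inductive constructible : sgraph -> Prop :=
| constructible_K5_minus_edge : constructible K5_minus_edge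
| constructible_H1 : constructible H1
| constructible_H2 : constructible H2
| constructible_add_edge (G : sgraph) (a b : G) :
    a != b -> ~~ adj a b -> constructible G -> constructible (add_edge a b)
| constructible_one_extension (G : sgraph) (a b c : G) :
    adj a b -> c != a -> c != b -> constructible G ->
    constructible (one_extension a b c)
| constructible_iso (G H : sgraph) :
    isomorphic G H -> constructible G -> constructible H.

Section Frameworks.
Variable R : realType.

Definition alg_independent (I : finType) (t : I -> R) : Prop :=
  forall P : {mpoly rat[#|I|]}, P != 0 ->
    (map_mpoly ratr P).@[fun k => t (enum_val k)] != 0 :> R.

Definition generic (V : finType) (p : V -> 'rV[R]_3) : Prop :=
  alg_independent (fun vk : V * 'I_3 => p vk.1 0 vk.2).

(* The library norm on 'rV[R]_3 is the sup norm, hence an explicit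
   Euclidean distance. *)
Definition edist (x y : 'rV[R]_3) : R :=
  Num.sqrt (\sum_(k < 3) (x 0 k - y 0 k) ^+ 2).

(* [r] is the square of the radius, not the radius. *)
Definition cylinder (r : R) (x : 'rV[R]_3) : Prop :=
  x 0 0 ^+ 2 + x 0 1 ^+ 2 = r.

Definition on_cylinders (V : finType) (p q : V -> 'rV[R]_3) : Prop :=
  forall v, cylinder (p v 0 0 ^+ 2 + p v 0 1 ^+ 2) (q v).

Definition globally_rigid (G : sgraph) (p : G -> 'rV[R]_3) : Prop :=
  forall q : G -> 'rV[R]_3, on_cylinders p q ->
    (forall u v, adj u v -> edist (q u) (q v) = edist (p u) (p v)) ->
    forall u v, edist (q u) (q v) = edist (p u) (p v).

End Frameworks.

(* Main.v *)
From HB Require Import structures.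
Require Import Defs.
From mathcomp Require Import mpoly.
From mathcomp Require Import all_boot all_order all_algebra.
From mathcomp Require Import zify ring lra.
From mathcomp Require Import reals boolp.

Set Implicit Arguments.
Unset Strict Implicit.
Unset Printing Implicit Defensive.

Import Order.TTheory GRing.Theory Num.Theory.
Local Open Scope ring_scope.

(** A stress of a framework on concentric cylinders consists of edge weights [w]
    and vertex weights [l] such that the weighted Laplacian [L] of [w] kills the
    z-coordinates and [L + diag l] kills the x- and y-coordinates.  Its rank is
    maximal if the kernels are spanned by the constants and the z-coordinates,
    resp. by the x- and y-coordinates.

    A generic [p] with such a stress is globally rigid.  If [q] has the same
    radii and edge lengths as [p], then every stress of [p] is one of [q]:
    differentiation at [q] is a derivation of the ring generated by the
    measurements, which has the same values at [p] and at [q], and in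
    characteristic 0 it extends to the coordinates of [p].  So the column space
    of the Jacobian at [q] is contained in the one at [p], and a stress, being
    orthogonal to the latter, is orthogonal to the former.  By maximality of the
    rank [q] is then a linear image of [p] in the plane and an affine one along
    the axis, and the radii and one edge force an isometry.

    It remains to find one rational configuration that is infinitesimally rigid
    and has a nowhere zero stress of maximal rank, since this is a Zariski open
    condition.  For the base graphs it is exhibited.  An added edge carries a
    second stress, by rigidity, and a generic combination of the two works.
    For a 1-extension the new vertex is put at the midpoint of the deleted edge,
    whose weight is split between the two halves, and is then moved away. *)

(** * Kernels of polynomial families of matrices *)

Definition in_ker (K : fieldType) (I J : finType) (A : I -> J -> K)
    (h : J -> K) := forall i, \sum_j A i j * h j = 0.

(** Dimension at most 2, expressed as containment of the kernel in the span of two arbitrary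
    vectors. *)
Definition ker_le2 (K : fieldType) (I J : finType) (A : I -> J -> K) :=
  exists e f : J -> K, forall h, in_ker A h ->
    exists s t, forall j, h j = s * e j + t * f j.

Definition ker_ge2 (K : fieldType) (I J : finType) (A : I -> J -> K) :=
  exists e f : J -> K, [/\ in_ker A e, in_ker A f &
    exists j1 j2, e j1 * f j2 - e j2 * f j1 != 0].

(** Families indexed by finite types become matrices through [enum_val], which gives access to ranks
    and determinants. *)
Definition fam_mx (T : Type) (I J : finType) (A : I -> J -> T) :
    'M[T]_(#|I|, #|J|) :=
  \matrix_(i, j) A (enum_val i) (enum_val j).

Definition fam_cV (T : Type) (J : finType) (h : J -> T) : 'cV[T]_#|J| :=
  \col_j h (enum_val j).

Definition fam_rV (T : Type) (J : finType) (h : J -> T) : 'rV[T]_#|J| :=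
  \row_j h (enum_val j).

Definition pair_mx (T : Type) (J : finType) (e f : J -> T) : 'M[T]_(2, #|J|) :=
  \matrix_(i, j) (if i == 0 then e else f) (enum_val j).

Lemma pair_mxP (K : fieldType) (J : finType) (e f h : J -> K) :
  reflect (exists s t, forall j, h j = s * e j + t * f j)
          (fam_rV h <= pair_mx e f)%MS.
Proof.
apply: (iffP idP) => [/submxP[D DE]|[s [t st]]].
  exists (D 0 0), (D 0 1) => j.
  have /rowP/(_ (enum_rank j)) := DE.
  rewrite !mxE !big_ord_recl big_ord0 !mxE !enum_rankK addr0 /= => ->.
  by congr (_ + D 0 _ * _); apply: val_inj.
suff -> : fam_rV h = (\row_i (if i == 0 then s else t)) *m pair_mx e f.
  exact: submxMl.
by apply/rowP => j; rewrite !mxE !big_ord_recl big_ord0 !mxE addr0 st.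
Qed.

Lemma pair_mx_sub (K : fieldType) (J : finType) (e f : J -> K) (n : nat)
    (M : 'M[K]_(n, #|J|)) :
  (fam_rV e <= M)%MS -> (fam_rV f <= M)%MS -> (pair_mx e f <= M)%MS.
Proof.
move=> eM fM; apply/row_subP => i.
have -> : row i (pair_mx e f) = if i == 0 then fam_rV e else fam_rV f.
  by apply/rowP => j; rewrite !mxE; case: ifP => _; rewrite mxE.
by case: ifP.
Qed.

Lemma sum_enum_val (T : nmodType) (J : finType) (F : J -> T) :
  \sum_j F j = \sum_(k < #|J|) F (enum_val k).
Proof. exact: (big_enum_val (A := predT)). Qed.

Lemma fam_rV_mulE (T : pzRingType) (I J : finType) (A : I -> J -> T) w j :
  (fam_rV w *m fam_mx A) 0 (enum_rank j) = \sum_i w i * A i j.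
Proof.
rewrite mxE [RHS]sum_enum_val; apply: eq_bigr => k _.
by rewrite !mxE enum_rankK.
Qed.

Lemma fam_rV_ex (T : Type) (J : finType) (w : 'rV[T]_#|J|) :
  exists h, w = fam_rV h.
Proof.
exists (fun j => w 0 (enum_rank j)); apply/rowP => k.
by rewrite mxE enum_valK.
Qed.

Lemma in_kerE (K : fieldType) (I J : finType) (A : I -> J -> K) h :
  in_ker A h <-> fam_mx A *m fam_cV h = 0.
Proof.
split=> [Ah|Ah i].
  apply/colP => k; rewrite !mxE -[RHS](Ah (enum_val k)) [RHS]sum_enum_val.
  by apply: eq_bigr => l _; rewrite !mxE.
have /matrixP/(_ (enum_rank i) 0) := Ah; rewrite !mxE; apply: etrans.
rewrite [LHS]sum_enum_val; apply: eq_bigr => l _.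
by rewrite !mxE enum_rankK.
Qed.

Lemma rank_ker_le2 (K : fieldType) (I J : finType) (A : I -> J -> K) :
  ker_le2 A -> (#|J| <= \rank (fam_mx A) + 2)%N.
Proof.
move=> [e [f ef]].
set M := (fam_mx A)^T.
have sub : (kermx M <= pair_mx e f)%MS.
  apply/row_subP => i.
  have [h hE] := fam_rV_ex (row i (kermx M)).
  rewrite hE; apply/pair_mxP/ef/in_kerE; apply: trmx_inj.
  rewrite trmx_mul trmx0.
  have -> : (fam_cV h)^T = fam_rV h by apply/rowP => j; rewrite !mxE.
  by rewrite -hE -row_mul mulmx_ker row0.
have := mxrankS sub; rewrite mxrank_ker mxrank_tr.
have := rank_leq_row (pair_mx e f).
lia.
Qed.

Lemma rank_pair_mx (K : fieldType) (J : finType) (e f : J -> K) j1 j2 :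
  e j1 * f j2 - e j2 * f j1 != 0 -> \rank (pair_mx e f) = 2%N.
Proof.
move=> det0; apply/eqP; rewrite eqn_leq rank_leq_row /=.
pose g (k : 'I_2) := if k == 0 then enum_rank j1 else enum_rank j2.
have u : colsub g (pair_mx e f) \in unitmx.
  rewrite unitmxE unitfE (expand_det_row _ 0) !big_ord_recl big_ord0 addr0.
  rewrite /cofactor !det_mx11 !mxE /= /g /= !enum_rankK.
  by rewrite addn0 expr0 expr1 !mul1r mulN1r mulrN.
rewrite -[X in (X <= _)%N](mxrank_unit u).
by rewrite -[X in colsub _ X]mulmx1 -mulmx_colsub mxrankM_maxl.
Qed.

Lemma in_ker_sub (K : fieldType) (I J : finType) (A : I -> J -> K) h :
  in_ker A h -> (fam_rV h <= kermx (fam_mx A)^T)%MS.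
Proof.
move=> /in_kerE Ah; apply/sub_kermxP; apply: trmx_inj.
rewrite trmx_mul trmxK trmx0 -{}Ah; congr (_ *m _).
by apply/colP => j; rewrite !mxE.
Qed.

Lemma rank_ker_ge2 (K : fieldType) (I J : finType) (A : I -> J -> K) :
  ker_ge2 A -> (\rank (fam_mx A) + 2 <= #|J|)%N.
Proof.
move=> [e [f [Ae Af [j1 [j2 det0]]]]].
have := mxrankS (pair_mx_sub (in_ker_sub Ae) (in_ker_sub Af)).
rewrite (rank_pair_mx det0) mxrank_ker mxrank_tr.
have := rank_leq_col (fam_mx A); lia.
Qed.

(** The rank bound leaves at most 2 dimensions for the kernel, and the independent vectors [e] and
    [f] fill them. A rank bound survives deformation; this lemma converts it back into explicit
    spanning vectors. *)
Lemma ker_span2 (K : fieldType) (I J : finType) (A : I -> J -> K)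
    (e f : J -> K) :
  (#|J| <= \rank (fam_mx A) + 2)%N -> in_ker A e -> in_ker A f ->
  (exists j1 j2, e j1 * f j2 - e j2 * f j1 != 0) ->
  forall h, in_ker A h -> exists s t, forall j, h j = s * e j + t * f j.
Proof.
move=> rA Ae Af [j1 [j2 det0]] h Ah.
have sub := pair_mx_sub (in_ker_sub Ae) (in_ker_sub Af).
apply/pair_mxP; apply: submx_trans (in_ker_sub Ah) _.
rewrite -(mxrank_leqif_sup sub) (rank_pair_mx det0) mxrank_ker mxrank_tr.
have := mxrankS sub; rewrite (rank_pair_mx det0) mxrank_ker mxrank_tr; lia.
Qed.

(** A row basis is picked first, then a column basis of the selected rows. *)
Lemma full_minor (K : fieldType) (a b : nat) (M : 'M[K]_(a, b)) :
  exists (f : 'I_(\rank M) -> 'I_a) (g : 'I_(\rank M) -> 'I_b),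
    mxsub f g M \in unitmx.
Proof.
have rf := maxrowsub_free M; set f := maxrankfun M in rf.
have full : row_full (rowsub f M)^T.
  by move: rf; rewrite /row_free /row_full mxrank_tr => /eqP ->.
exists f, (fullrankfun full).
have := fullrowsub_unit full.
by rewrite -unitmx_tr; congr (_ \in unitmx); apply/matrixP => i j; rewrite !mxE.
Qed.

Lemma mxsub_mul (T : nzRingType) (a b c d : nat) (M : 'M[T]_(a, b))
    (f : 'I_c -> 'I_a) (g : 'I_d -> 'I_b) :
  mxsub f g M = rowsub f 1%:M *m M *m colsub g 1%:M.
Proof.
rewrite mul_rowsub_mx mul1mx mulmx_colsub mulmx1.
by apply/matrixP => i j; rewrite !mxE.
Qed.

Lemma rank_minor (K : fieldType) (a b r : nat) (M : 'M[K]_(a, b))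
    (f : 'I_r -> 'I_a) (g : 'I_r -> 'I_b) :
  \det (mxsub f g M) != 0 -> (r <= \rank M)%N.
Proof.
rewrite -unitfE -unitmxE => u; rewrite -[X in (X <= _)%N](mxrank_unit u).
by rewrite mxsub_mul (leq_trans (mxrankM_maxl _ _)) // mxrankM_maxr.
Qed.

Lemma map_fam_mx (T U : Type) (I J : finType) (A : I -> J -> T) (g : T -> U) :
  map_mx g (fam_mx A) = fam_mx (fun i j => g (A i j)).
Proof. by apply/matrixP => i j; rewrite !mxE. Qed.

(** Semicontinuity of the rank: [d] is a nonzero minor of maximal size at [ev0], and wherever it
    survives the rank is at least as large. The ring [S] is abstract because it serves both for
    polynomials in the coordinates and for polynomials in one parameter. *)
Lemma ker_le2_open (S : comNzRingType) (F : fieldType) (ev0 : {rmorphism S -> F})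
    (I J : finType) (A : I -> J -> S) :
  ker_le2 (fun i j => ev0 (A i j)) ->
  exists2 d : S, ev0 d != 0 &
    forall (K : fieldType) (ev : {rmorphism S -> K}), ev d != 0 ->
      (#|J| <= \rank (fam_mx (fun i j => ev (A i j))) + 2)%N.
Proof.
move=> /rank_ker_le2; rewrite -map_fam_mx => r0.
have [f [g u]] := full_minor (map_mx ev0 (fam_mx A)).
exists (\det (mxsub f g (fam_mx A))).
  by rewrite -det_map_mx map_mxsub -unitfE -unitmxE.
move=> K ev; rewrite -det_map_mx map_mxsub => /rank_minor rK.
by rewrite -map_fam_mx (leq_trans r0) // leq_add2r.
Qed.

(* With [B] an invertible minor of maximal size at [ev0], cut out by the
   selection matrices [V] and [U], Cramer's rule makes
   [w = \det B w0 - w0 A U (\adj B) V] a polynomial cokernel vector. *)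
Lemma cokernel_extend (S : comNzRingType) (F : fieldType)
    (ev0 : {rmorphism S -> F}) (I J : finType) (A : I -> J -> S) (w0 : I -> S) :
  ker_le2 (fun i j => ev0 (A i j)) ->
  (forall j, \sum_i ev0 (w0 i) * ev0 (A i j) = 0) ->
  exists (d : S) (w : I -> S), [/\ ev0 d != 0,
    forall i, ev0 (w i) = ev0 d * ev0 (w0 i) &
    forall (K : fieldType) (ev : {rmorphism S -> K}), ev d != 0 ->
      ker_ge2 (fun i j => ev (A i j)) ->
      forall j, \sum_i ev (w i) * ev (A i j) = 0].
Proof.
move=> /rank_ker_le2 r0 w00.
rewrite -map_fam_mx in r0; set C := fam_mx A in r0.
have [f [g u]] := full_minor (map_mx ev0 C).
set r := \rank (map_mx ev0 C) in f g u r0.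
set B := mxsub f g C.
pose U : 'M[S]_(_, r) := colsub g 1%:M.
pose V : 'M[S]_(r, _) := rowsub f 1%:M.
have BE : B = V *m C *m U by rewrite /B mxsub_mul.
pose W0 := fam_rV w0.
pose W := \det B *: W0 - W0 *m C *m U *m \adj B *m V.
have [w wE] := fam_rV_ex W.
exists (\det B), w; split.
- by rewrite -det_map_mx map_mxsub -unitfE -unitmxE.
- move=> i.
  have /rowP/(_ (enum_rank i)) := congr1 (map_mx ev0) wE.
  (* The correction term of [W] contains the factor [W0 *m C], which vanishes at [ev0]. *)
  have -> : map_mx ev0 W = ev0 (\det B) *: map_mx ev0 W0.
    rewrite map_mxB map_mxZ !map_mxM.
    suff -> : map_mx ev0 W0 *m map_mx ev0 C = 0 by rewrite !mul0mx subr0.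
    apply/rowP => j; rewrite [RHS]mxE -[RHS](w00 (enum_val j)) mxE.
    by rewrite [RHS]sum_enum_val; apply: eq_bigr => k _; rewrite !mxE.
  by rewrite !mxE enum_rankK.
move=> K ev d0 /rank_ker_ge2; rewrite -map_fam_mx -/C => rK.
have WCU : W *m C *m U = 0.
  rewrite /W !mulmxBl -!scalemxAl.
  have -> : W0 *m C *m U *m \adj B *m V *m C *m U =
            W0 *m C *m U *m (\adj B *m B) by rewrite BE !mulmxA.
  by rewrite mul_adj_mx mul_mx_scalar subrr.
pose CK := map_mx ev C; pose UK := map_mx ev U.
have sub : ((CK *m UK)^T <= CK^T)%MS by rewrite trmx_mul submxMl.
(* At [ev] the rank is at most [r], while the combinations of columns given by [U] already have rank
   [r]. They span the column space, so [W *m C *m U = 0] forces [W *m C = 0] there. *)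
have sup : (CK^T <= (CK *m UK)^T)%MS.
  rewrite -(mxrank_leqif_sup sub) eqn_leq mxrankS //= !mxrank_tr.
  apply: (@leq_trans r); first by rewrite -(leq_add2r 2) (leq_trans rK).
  have u' : map_mx ev V *m (CK *m UK) \in unitmx.
    by rewrite mulmxA -!map_mxM -BE unitmxE unitfE det_map_mx.
  by have := mxrankM_maxr (map_mx ev V) (CK *m UK); rewrite (mxrank_unit u').
have /submxP[D DE] := sup.
have CKE : CK = CK *m UK *m D^T.
  by apply: trmx_inj; rewrite {1}DE [in RHS]trmx_mul trmxK.
have WK : map_mx ev W *m CK = 0.
  rewrite CKE !mulmxA -!map_mxM WCU.
  by rewrite map_mx0 mul0mx.
move=> j; have := fam_rV_mulE (fun i j => ev (A i j)) (fun i => ev (w i)) j.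
rewrite -map_fam_mx -/C => <-.
have -> : fam_rV (fun i => ev (w i)) = map_mx ev W.
  by rewrite wE; apply/rowP => k; rewrite !mxE.
by rewrite WK mxE.
Qed.

(** The columns of [cokermx] are kernel vectors, and being orthogonal to all of them characterises
    the row space. *)
Lemma row_span (K : fieldType) (I J : finType) (A : I -> J -> K) (r : J -> K) :
  (forall h, in_ker A h -> \sum_j r j * h j = 0) ->
  exists w : I -> K, forall j, r j = \sum_i w i * A i j.
Proof.
move=> rA.
have : (fam_rV r <= fam_mx A)%MS.
  rewrite submxE; apply/eqP/rowP => k; rewrite [RHS]mxE.
  set Q := cokermx _.
  have Ah : in_ker A (fun j => Q (enum_rank j) k).
    apply/in_kerE; set h := fam_cV _.
    have -> : h = col k Q by apply/colP => l; rewrite !mxE enum_valK.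
    by rewrite colE mulmxA mulmx_coker mul0mx.
  rewrite mxE; apply: etrans (rA _ Ah).
  rewrite [RHS]sum_enum_val; apply: eq_bigr => l _.
  by rewrite !mxE enum_valK.
move=> /submxP[D DE]; have [w wE] := fam_rV_ex D.
exists w => j; rewrite -fam_rV_mulE -wE -DE mxE enum_rankK //.
Qed.

(** * Extension of derivations *)

Section DerivationExtension.

(* [D] need not be given on the quotient of [A] by the kernel of [phi]: the last
   condition makes it factor through it. *)
Definition derivation_along (A : idomainType) (R : fieldType)
    (phi : {rmorphism A -> R}) (D : A -> R) :=
  [/\ {morph D : a b / a + b}, forall a b, D (a * b) = phi a * D b + D a * phi b
    & forall a, phi a = 0 -> D a = 0].

Variables (A : idomainType) (R : numFieldType).
Variables (phi : {rmorphism A -> R}) (D : A -> R) (x : R).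
Hypothesis derD : derivation_along phi D.

Let D0 : D 0 = 0. Proof. by case: derD => _ _; apply; rewrite rmorph0. Qed.

Let mapD_add : {morph map_poly D : F G / F + G}.
Proof.
case: derD => Dadd _ _ F G; apply/polyP => i.
by rewrite coefD !coef_map_id0 // coefD Dadd.
Qed.

Let D_sum (I : Type) (s : seq I) (F : I -> A) :
  D (\sum_(i <- s) F i) = \sum_(i <- s) D (F i).
Proof. by case: derD => Dadd _ _; apply: big_morph. Qed.

Let mapD_mul F G : map_poly D (F * G) =
  map_poly phi F * map_poly D G + map_poly D F * map_poly phi G.
Proof.
case: derD => Dadd Dmul _; apply/polyP => i.
rewrite coefD coef_map_id0 // !coefM D_sum -big_split /=.
by apply: eq_bigr => j _; rewrite Dmul !coef_map !coef_map_id0.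
Qed.

Let mapD_lift F : map_poly phi F = 0 -> map_poly D F = 0.
Proof.
case: derD => _ _ Dker F0; apply/polyP => i; rewrite coef_map_id0 // coef0.
by apply: Dker; rewrite -coef_map F0 coef0.
Qed.

(** [D] on the coefficients and the value [e] on the variable: the general shape of an extension of
    [D] along evaluation at [x]. *)
Definition poly_der (e : R) (F : {poly A}) : R :=
  (map_poly D F).[x] + (map_poly phi F^`()).[x] * e.

Definition poly_ev : {poly A} -> R := horner_eval x \o map_poly phi.

HB.instance Definition _ := GRing.RMorphism.on poly_ev.

Lemma poly_evE F : poly_ev F = (map_poly phi F).[x].
Proof. by []. Qed.

Lemma poly_derD e : {morph poly_der e : F G / F + G}.
Proof.
by move=> F G; rewrite /poly_der mapD_add derivD rmorphD /= !hornerD; ring.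
Qed.

Lemma poly_derM e F G :
  poly_der e (F * G) = poly_ev F * poly_der e G + poly_der e F * poly_ev G.
Proof.
rewrite /poly_der mapD_mul derivM !poly_evE rmorphD !rmorphM /=.
by rewrite !(hornerD, hornerM); ring.
Qed.

Lemma poly_der_small e F : map_poly phi F = 0 -> poly_der e F = 0.
Proof.
move=> F0; rewrite /poly_der mapD_lift // -deriv_map F0 deriv0.
by rewrite horner0 mul0r addr0.
Qed.

Lemma minimal_relation :
  (forall F, poly_ev F = 0 -> map_poly phi F = 0) \/
  exists P : {poly A}, [/\ poly_ev P = 0, map_poly phi P != 0 &
    forall F : {poly A}, (size F < size P)%N -> poly_ev F = 0 -> map_poly phi F = 0].
Proof.
case: (pselect (exists P, poly_ev P = 0 /\ map_poly phi P != 0)); last first.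
  by move=> no; left => F F0; apply: contra_notP no => /eqP Fn; exists F.
move=> [P0 [evP0 P0n]]; right.
have [n] := ubnP (size P0); elim: n P0 evP0 P0n => // n IH P P0 Pn sP.
case: (pselect (exists F : {poly A}, [/\ (size F < size P)%N, poly_ev F = 0
                            & map_poly phi F != 0])).
  by move=> [F [sF F0 Fn]]; apply: (IH F) => //; apply: leq_trans sF _.
move=> no; exists P; split=> // F sF F0.
by apply: contra_notP no => /eqP Fn; exists F.
Qed.

(* If [x] is transcendental over the image of [phi], any value of the
   derivative of [x] will do; if it is algebraic, a relation of minimal degree
   is separable and forces the value. *)
Lemma derivation_poly : exists e, derivation_along poly_ev (poly_der e).
Proof.
have [tr|[P [P0 Pn Pmin]]] := minimal_relation.
  exists 0; split; [exact: poly_derD|exact: poly_derM|move=> F F0].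
  exact/poly_der_small/tr.
have Pneq0 : P != 0 by apply: contra_neq Pn => ->; rewrite rmorph0.
have lcP : phi (lead_coef P) != 0.
  (* If [phi] killed the leading coefficient, dropping it would give a shorter relation with the
     same image. *)
  apply: contra_neq Pn => lc0.
  have mE : map_poly phi (take_poly (size P).-1 P) = map_poly phi P.
    apply/polyP => i; rewrite !coef_map coef_take_poly /=.
    case: ltnP => // le_i; rewrite rmorph0.
    move: le_i; rewrite leq_eqVlt.
    case/orP=> [/eqP <-|lt_i]; first by rewrite -lead_coefE lc0.
    rewrite nth_default ?raddf0 // -(prednK (_ : 0 < size P)%N) //.
    by rewrite size_poly_gt0.
  rewrite -mE; apply: Pmin; last by rewrite poly_evE mE -poly_evE.
  by rewrite (leq_ltn_trans (size_take_poly _ _)) // prednK // size_poly_gt0.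
(* Separability: the derivative of [P] is shorter than [P], so if it vanished at [x] its image would
   be 0. In characteristic 0 the image of [P] would then be a constant vanishing at [x], hence 0. *)
have dP : poly_ev P^`() != 0.
  apply/eqP => /(Pmin _ (lt_size_deriv Pneq0)).
  rewrite -deriv_map => d0.
  have sz : (size (map_poly phi P) <= 1)%N.
    rewrite leqNgt; apply/negP => lt1.
    have /polyP/(_ (size (map_poly phi P)).-2) := d0.
    rewrite coef_deriv coef0 => /eqP; rewrite mulrn_eq0 /=.
    have -> : (size (map_poly phi P)).-2.+1 = (size (map_poly phi P)).-1 by lia.
    by rewrite -lead_coefE lead_coef_eq0 (negPf Pn).
  move: P0 Pn; rewrite poly_evE (size1_polyC sz) hornerC => ->.
  by rewrite polyC0 eqxx.
(* The only value of [e] for which [poly_der e P = 0]. *)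
exists (- (map_poly D P).[x] / poly_ev P^`()).
set e := - _ / _.
have DP : poly_der e P = 0.
  by rewrite /poly_der -poly_evE /e mulrC divfK // addrN.
split; [exact: poly_derD|exact: poly_derM|move=> F F0].
(* Pseudo-division, since [A] is only a domain: [F] gets multiplied by a power [c] of the leading
   coefficient, and [phi c] is nonzero. *)
have rel := Pdiv.WeakIdomain.divp_eq F P.
set c := lead_coef P ^+ _ in rel.
have c0 : phi c != 0 by rewrite rmorphXn expf_neq0.
rewrite -mul_polyC in rel.
have evc : poly_ev c%:P = phi c by rewrite poly_evE map_polyC hornerC.
have ev_mod : poly_ev (F %% P) = 0.
  have := congr1 poly_ev rel.
  by rewrite rmorphD !rmorphM /= F0 P0 !mulr0 add0r => /esym.
have D_mod : poly_der e (F %% P) = 0.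
  by apply/poly_der_small/Pmin; rewrite ?Pdiv.CommonIdomain.ltn_modpN0.
have := congr1 (poly_der e) rel.
rewrite poly_derD !poly_derM D_mod DP F0 P0 !mulr0 !addr0 evc => /eqP.
by rewrite mulf_eq0 (negPf c0) => /eqP.
Qed.

End DerivationExtension.

(** The elements of [xs] are adjoined one at a time, each as a new polynomial variable: [B] is an
    iterated polynomial ring and [j] the inclusion of constants. *)
Lemma derivation_lift (R : numFieldType) (A : idomainType)
    (phi : {rmorphism A -> R}) (D : A -> R) (xs : seq R) :
  derivation_along phi D ->
  exists (B : idomainType) (psi : {rmorphism B -> R}) (E : B -> R) (j : A -> B)
    (X : nat -> B), [/\ derivation_along psi E, forall a, psi (j a) = phi a,
    forall a, E (j a) = D a & forall i, (i < size xs)%N -> psi (X i) = nth 0 xs i].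
Proof.
elim: xs A phi D => [|x xs IH] A phi D derD.
  by exists A, phi, D, id, (fun=> 0); split.
have [e dere] := derivation_poly x derD.
have [B [psi [E [j [X [derE psij Ej psiX]]]]]] := IH _ _ _ dere.
exists B, psi, E, (fun a => j a%:P), (fun i => if i is i'.+1 then X i' else j 'X).
split=> //.
- by move=> a; rewrite psij /= poly_evE map_polyC hornerC.
- move=> a; rewrite Ej /poly_der derivC rmorph0 horner0 mul0r addr0.
  case: derD => _ _ Dker; have D0 : D 0 = 0 by rewrite Dker ?rmorph0.
  suff -> : map_poly D a%:P = (D a)%:P by rewrite hornerC.
  by apply/polyP => i; rewrite coef_map_id0 // !coefC; case: ifP.
by case=> [_|i /psiX //]; rewrite psij /= poly_evE map_polyX hornerX.
Qed.

(** * Frameworks on cylinders and their stresses *)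

Lemma ord3P (k : 'I_3) : [\/ k = 0, k = 1 | k = 2].
Proof.
case: k => [[|[|[|//]]]] lk; [apply: Or31|apply: Or32|apply: Or33];
  exact: val_inj.
Qed.

Lemma sum3 (T : nmodType) (F : 'I_3 -> T) :
  \sum_k F k = F 0 + F 1 + F 2.
Proof.
rewrite !big_ord_recl big_ord0 addr0 addrA.
by congr (_ + F _ + F _); apply: val_inj.
Qed.

Definition planar (k : 'I_3) : bool := (k < 2)%N.

Section Frameworks.
Variables (V : finType) (e : rel V).
Implicit Types (S : comNzRingType) (K : fieldType).

(* Half the Jacobian of the squared radii [inl u] and of the squared lengths
   [inr (u, v)] at the configuration [t]. *)
Definition rig_row S (t : V * 'I_3 -> S) (i : V + V * V) (j : V * 'I_3) : S :=
  match i with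
  | inl u => (j.1 == u)%:R * (planar j.2)%:R * t j
  | inr (u, v) => (e u v)%:R * (t (u, j.2) - t (v, j.2)) *
                  ((j.1 == u)%:R - (j.1 == v)%:R)
  end.

(** Velocity of the rotation about the common axis; with the translation along the axis it spans the
    trivial motions. *)
Definition rotation S (t : V * 'I_3 -> S) (j : V * 'I_3) : S :=
  if j.2 == 0 then - t (j.1, 1) else if j.2 == 1 then t (j.1, 0) else 0.

Definition translation S (j : V * 'I_3) : S := (j.2 == 2)%:R.

Definition rigid K (t : V * 'I_3 -> K) := forall h, in_ker (rig_row t) h ->
  exists a b, forall j, h j = a * rotation t j + b * translation K j.

(* The weighted Laplacian of [w], plus the diagonal of [l] if [b]: [b] is true
   for the two coordinates in the plane and false for the one along the axis. *)
Definition stress_mx S (b : bool) (w : V -> V -> S) (l : V -> S) u v : S :=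
  (u == v)%:R * (\sum_x w u x + b%:R * l u) - w u v.

Definition is_stress K (t : V * 'I_3 -> K) (w : V -> V -> K) (l : V -> K) :=
  [/\ forall u v, w u v = w v u, forall u v, ~~ e u v -> w u v = 0 &
      forall k, in_ker (stress_mx (planar k) w l) (fun v => t (v, k))].

Definition max_rank K (t : V * 'I_3 -> K) (w : V -> V -> K) (l : V -> K) :=
  (forall h, in_ker (stress_mx true w l) h ->
     exists a b, forall u, h u = a * t (u, 0) + b * t (u, 1)) /\
  (forall h, in_ker (stress_mx false w l) h ->
     exists a b, forall u, h u = a * 1 + b * t (u, 2)).

Definition minor S (t : V * 'I_3 -> S) u v : S :=
  t (u, 0) * t (v, 1) - t (v, 0) * t (u, 1).

(** When nonzero, the planar projections are pairwise independent and two heights differ. One minor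
    makes the planar coordinates independent, the heights do so for the constants and the
    z-coordinates, and the three minors together detect a zero quadratic form. A single product
    keeps the condition polynomial. *)
Definition nondeg S (t : V * 'I_3 -> S) a b c : S :=
  minor t a b * minor t a c * minor t b c * (t (b, 2) - t (a, 2)).

(* [N] are the pairs on which the stress must not vanish; all the edges, except
   right after a 1-extension, where one edge has weight 0. *)
Definition good K (N : rel V) (t : V * 'I_3 -> K) :=
  [/\ exists a b c, nondeg t a b c != 0, rigid t &
      exists w l, [/\ is_stress t w l, forall u v, N u v -> w u v != 0
                    & max_rank t w l]].

Lemma sum_pair S (F : V * 'I_3 -> S) : \sum_j F j = \sum_u \sum_k F (u, k).
Proof. by rewrite pair_big; apply: eq_bigr => -[]. Qed.

Lemma sum_delta S (F : V -> S) u : \sum_v (v == u)%:R * F v = F u.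
Proof.
rewrite (bigD1 u) //= eqxx mul1r big1 ?addr0 // => v /negPf ->.
by rewrite mul0r.
Qed.

Lemma rig_row_sum S (t : V * 'I_3 -> S) (i : V + V * V) h :
  \sum_j rig_row t i j * h j =
  match i with
  | inl u => t (u, 0) * h (u, 0) + t (u, 1) * h (u, 1)
  | inr (u, v) => (e u v)%:R *
      \sum_k (t (u, k) - t (v, k)) * (h (u, k) - h (v, k))
  end.
Proof.
rewrite sum_pair exchange_big /=; case: i => [u|[u v]] /=.
  transitivity (\sum_k (planar k)%:R * t (u, k) * h (u, k)).
    apply: eq_bigr => k _.
    rewrite -(sum_delta (fun x => (planar k)%:R * t (x, k) * h (x, k)) u).
    by apply: eq_bigr => x _; rewrite !mulrA.
  by rewrite sum3 /planar /=; ring.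
rewrite mulr_sumr; apply: eq_bigr => k _.
rewrite -(sum_delta (fun x => h (x, k)) u) -(sum_delta (fun x => h (x, k)) v).
by rewrite -sumrB !mulr_sumr; apply: eq_bigr => x _; ring.
Qed.

Lemma stress_mx_sum S b (w : V -> V -> S) l (h : V -> S) u :
  \sum_v stress_mx b w l u v * h v =
  \sum_v w u v * (h u - h v) + b%:R * l u * h u.
Proof.
transitivity ((\sum_v (v == u)%:R * ((\sum_x w v x + b%:R * l v) * h v))
              - \sum_v w u v * h v).
  rewrite -sumrB; apply: eq_bigr => v _; rewrite /stress_mx [u == v]eq_sym.
  by case: eqP => [->|_] /=; ring.
rewrite sum_delta mulrDl mulr_suml addrAC -sumrB.
by congr (_ + _); apply: eq_bigr => v _; rewrite mulrBr.
Qed.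

(** A linear dependency among the rows of the Jacobian is an equilibrium: each edge collects the
    weights of its two orientations. *)
Lemma rig_col_sum S (t : V * 'I_3 -> S) (w : V + V * V -> S) u k :
  symmetric e ->
  \sum_i w i * rig_row t i (u, k) =
  \sum_v stress_mx (planar k)
    (fun x y => (e x y)%:R * (w (inr (x, y)) + w (inr (y, x))))
    (w \o inl) u v * t (v, k).
Proof.
move=> esym; rewrite big_sumType /= addrC; symmetry.
rewrite (stress_mx_sum _ _ _ (fun v => t (v, k))) /=.
congr (_ + _); last first.
  rewrite -(sum_delta (fun x => (planar k)%:R * w (inl x) * t (x, k)) u).
  apply: eq_bigr => x _; rewrite eq_sym; case: eqP => [->|_] /=; ring.
transitivity (\sum_x \sum_y ((u == x)%:R *
   (w (inr (x, y)) * (e x y)%:R * (t (x, k) - t (y, k))) +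
   (u == y)%:R * (w (inr (x, y)) * (e x y)%:R * (t (y, k) - t (x, k))))).
  under [RHS]eq_bigr do rewrite big_split; rewrite big_split /=.
  rewrite [X in _ = _ + X]exchange_big /= -big_split /=.
  rewrite -(sum_delta (fun u => \sum_v (e u v)%:R *
    (w (inr (u, v)) + w (inr (v, u))) * (t (u, k) - t (v, k))) u).
  apply: eq_bigr => x _; rewrite -!mulr_sumr -mulrDr [u == x]eq_sym.
  congr (_ * _); rewrite -big_split /=; apply: eq_bigr => y _.
  by rewrite [e y x]esym; ring.
rewrite pair_big; apply: eq_bigr => -[x y] _ /=.
by ring.
Qed.

(** The factor 2 matches the edges, which occur once in each orientation. *)
Definition stress_covector S (w : V -> V -> S) (l : V -> S) (i : V + V * V) : S :=
  match i with inl u => 2 * l u | inr (u, v) => w u v end.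

Lemma stress_covector_sum S (t : V * 'I_3 -> S) w l u k : symmetric e ->
  (forall u v, w u v = w v u) -> (forall u v, ~~ e u v -> w u v = 0) ->
  \sum_i stress_covector w l i * rig_row t i (u, k) =
  2 * \sum_v stress_mx (planar k) w l u v * t (v, k).
Proof.
move=> e_sym w_sym w_supp; rewrite rig_col_sum // mulr_sumr.
apply: eq_bigr => v _; rewrite mulrA; congr (_ * _).
have E x y : (e x y)%:R * (w x y + w y x) = 2 * w x y.
  by rewrite [w y x]w_sym; case: (boolP (e x y)) => [_|/w_supp ->] /=; ring.
rewrite /stress_mx /= E.
under eq_bigr do rewrite E.
by rewrite -mulr_sumr; ring.
Qed.

Section Morphism.
Variables (S S' : comNzRingType) (f : {rmorphism S -> S'}).

Lemma rmorph_rig_row t i j : f (rig_row t i j) = rig_row (f \o t) i j.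
Proof.
by case: i => [u|[u v]] /=; rewrite !(rmorphM, rmorphB, rmorph_nat).
Qed.

Lemma rmorph_stress_mx b w l u v :
  f (stress_mx b w l u v) = stress_mx b (fun x y => f (w x y)) (f \o l) u v.
Proof.
by rewrite /stress_mx !(rmorphM, rmorphB, rmorphD, rmorph_nat, rmorph_sum).
Qed.

Lemma rmorph_nondeg t a b c : f (nondeg t a b c) = nondeg (f \o t) a b c.
Proof. by rewrite /nondeg /minor !(rmorphM, rmorphB). Qed.

End Morphism.

Lemma eq_in_ker K (I J : finType) (A B : I -> J -> K) h :
  (forall i j, A i j = B i j) -> in_ker A h -> in_ker B h.
Proof.
by move=> AB Ah i; rewrite -[RHS](Ah i); apply: eq_bigr => j _; rewrite AB.
Qed.

Lemma rotation_in_ker K (t : V * 'I_3 -> K) : in_ker (rig_row t) (rotation t).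
Proof.
move=> i; rewrite rig_row_sum; case: i => [u|[u v]].
  by rewrite /rotation /=; ring.
by rewrite sum3 /rotation /=; ring.
Qed.

Lemma translation_in_ker K (t : V * 'I_3 -> K) :
  in_ker (rig_row t) (translation K).
Proof.
move=> i; rewrite rig_row_sum; case: i => [u|[u v]].
  by rewrite /translation /=; ring.
by rewrite sum3 /translation /=; ring.
Qed.

Lemma trivial_motions_indep K (t : V * 'I_3 -> K) a b c : nondeg t a b c != 0 ->
  exists j1 j2,
    rotation t j1 * translation K j2 - rotation t j2 * translation K j1 != 0.
Proof.
rewrite !mulf_eq0 !negb_or => /andP[/andP[/andP[mab _] _] _].
case: (eqVneq (t (a, 1)) 0) => [t1|t1].
  exists (a, 1), (a, 2); rewrite /rotation /translation /= mul0r subr0 mulr1.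
  by apply: contraNneq mab => t0; rewrite /minor t0 t1; apply/eqP; ring.
exists (a, 0), (a, 2); rewrite /rotation /translation /= mul0r subr0 mulr1.
by rewrite oppr_eq0.
Qed.

Lemma rig_ker_ge2 K (t : V * 'I_3 -> K) a b c : nondeg t a b c != 0 ->
  ker_ge2 (rig_row t).
Proof.
move=> nd; exists (rotation t), (translation K).
split; [exact: rotation_in_ker|exact: translation_in_ker|].
exact: trivial_motions_indep nd.
Qed.

Lemma constant_in_ker K (w : V -> V -> K) l :
  in_ker (stress_mx false w l) (fun=> 1).
Proof.
move=> u; rewrite stress_mx_sum mul0r mul0r addr0 big1 // => v _.
by rewrite subrr mulr0.
Qed.

End Frameworks.

(** * Evaluation of rational polynomials and Zariski openness of [good] *)

Lemma ratr_rat (x : rat) : ratr x = x.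
Proof. by rewrite -(fmorph_eq_rat idfun). Qed.

Section Evaluation.
Variables (J : finType) (K : numFieldType) (t : J -> K).

Definition evp : {mpoly rat[#|J|]} -> K :=
  meval (fun k => t (enum_val k)) \o map_mpoly (@ratr K).

HB.instance Definition _ := GRing.RMorphism.on evp.

Definition Xvar (j : J) : {mpoly rat[#|J|]} := 'X_(enum_rank j).

Lemma evpX j : evp (Xvar j) = t j.
Proof. by rewrite /evp /= /Xvar map_mpolyX mevalXU enum_rankK. Qed.

Lemma evpC c : evp c%:MP = ratr c.
Proof. by rewrite /evp /= map_mpolyC mevalC. Qed.

Lemma evp_comp_Xvar : evp \o Xvar = t.
Proof. by apply/funext => j /=; rewrite evpX. Qed.

End Evaluation.

Section Openness.
Variables (V : finType) (e N : rel V).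
Hypothesis e_sym : symmetric e.
Notation J := (V * 'I_3)%type.
Notation S := {mpoly rat[#|{: J}|]}.
Notation X := (@Xvar {: J}).

Lemma stress_ker_indep (K : fieldType) (t : J -> K) a b c :
  nondeg t a b c != 0 ->
  (exists j1 j2, t (j1, 0) * t (j2, 1) - t (j2, 0) * t (j1, 1) != 0) /\
  (exists j1 j2 : V, 1 * t (j2, 2) - 1 * t (j1, 2) != 0).
Proof.
rewrite !mulf_eq0 !negb_or => /andP[/andP[/andP[mab _] _] zab].
by split; exists a, b; rewrite ?mul1r.
Qed.

(** [D] is a product of polynomials, one for each requirement: the nondegeneracy product, minors of
    the Jacobian and of both stress matrices, and the weights on [N]. The stress itself becomes
    polynomial in the configuration by [cokernel_extend]. *)
Lemma good_open (t0 : J -> rat) : good e N t0 ->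
  exists2 D : S, evp t0 D != 0 &
    forall (K : numFieldType) (t : J -> K), evp t D != 0 -> good e N t.
Proof.
move=> [[a [b [c nd]]] rig [w [l [[w_sym w_supp w_eq] w_neq0 [ker1 ker0]]]]].
have evK (K : numFieldType) (t : J -> K) : evp t \o X = t := evp_comp_Xvar t.
have rowE (K : numFieldType) (t : J -> K) i j :
    evp t (rig_row e X i j) = rig_row e t i j.
  by rewrite rmorph_rig_row evK.
have ndE (K : numFieldType) (t : J -> K) : evp t (nondeg X a b c) = nondeg t a b c.
  by rewrite rmorph_nondeg evK.
have [D2 D2n D2P] : exists2 d : S, evp t0 d != 0 & forall (K : numFieldType)
    (t : J -> K), evp t d != 0 -> (#|{: J}| <= \rank (fam_mx (rig_row e t)) + 2)%N.
  have [|d d0 dP] := @ker_le2_open _ _ (evp t0) _ _ (rig_row e X).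
    exists (rotation t0), (translation rat) => h hk; apply: rig.
    by apply: eq_in_ker hk => i j; rewrite /= rowE.
  exists d => // K t td; have := dP _ (evp t) td.
  rewrite (_ : (fun i j => _) = rig_row e t) //.
  by apply/funext => i; apply/funext => j; rewrite /= rowE.
pose w0 (i : V + V * V) : S := (stress_covector w l i)%:MP.
have [||D3 [W [D3n WE WP]]] := @cokernel_extend _ _ (evp t0) _ _ (rig_row e X) w0.
- exists (rotation t0), (translation rat) => h hk; apply: rig.
  by apply: eq_in_ker hk => i j; rewrite /= rowE.
- move=> [u k].
  transitivity (\sum_i stress_covector w l i * rig_row e t0 i (u, k)).
    by apply: eq_bigr => i _; rewrite /= rowE evpC ratr_rat.
  by rewrite stress_covector_sum // w_eq mulr0.
(* Symmetrised over the two orientations, so that [rig_col_sum] turns the cokernel vector into a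
   stress. *)
pose wX u v : S := (e u v)%:R * (W (inr (u, v)) + W (inr (v, u))).
pose lX u : S := W (inl u).
have stressP (K : numFieldType) (t : J -> K) : evp t D3 != 0 ->
    nondeg t a b c != 0 ->
    is_stress e t (fun u v => evp t (wX u v)) (evp t \o lX).
  move=> tD3 tnd; split.
  - by move=> u v; rewrite /wX e_sym addrC.
  - by move=> u v /negPf euv; rewrite /wX euv mul0r rmorph0.
  move=> k u.
  have gk : ker_ge2 (fun i j => evp t (rig_row e X i j)).
    have -> : (fun i j => evp t (rig_row e X i j)) = rig_row e t.
      by apply/funext => i; apply/funext => j; rewrite rowE.
    exact: rig_ker_ge2 tnd.
  apply: etrans (WP _ (evp t) tD3 gk (u, k)).
  transitivity (\sum_i evp t (W i) * rig_row e t i (u, k)); last first.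
    by apply: eq_bigr => i _; rewrite /= rowE.
  rewrite (rig_col_sum _ (fun i => evp t (W i))) //; apply: eq_bigr => v _.
  congr (stress_mx _ _ _ _ _ * _); apply/funext => x; apply/funext => y.
  by rewrite /wX rmorphM rmorphD rmorph_nat.
(* At [t0] the polynomial stress is the given one times this nonzero factor, so supports and kernels
   agree there. *)
have d0 : evp t0 D3 * 2 != 0 by rewrite mulf_neq0.
have wX0 u v : evp t0 (wX u v) = evp t0 D3 * 2 * w u v.
  rewrite /wX rmorphM rmorphD rmorph_nat /= !WE /= !evpC !ratr_rat /= [w v u]w_sym.
  by case: (boolP (e u v)) => [_|/w_supp ->] /=; ring.
have lX0 u : evp t0 (lX u) = evp t0 D3 * 2 * l u.
  by rewrite /lX WE /= evpC ratr_rat /= mulrA.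
have mx0 bb u v : evp t0 (stress_mx bb wX lX u v) =
    evp t0 D3 * 2 * stress_mx bb w l u v.
  rewrite rmorph_stress_mx /stress_mx /= lX0 wX0.
  under eq_bigr do rewrite wX0.
  by rewrite -mulr_sumr; ring.
have kerE bb h : in_ker (fun u v => evp t0 (stress_mx bb wX lX u v)) h ->
    in_ker (stress_mx bb w l) h.
  move=> hk u; apply: (mulfI d0); rewrite mulr0; apply: etrans (hk u).
  rewrite mulr_sumr.
  by apply: eq_bigr => v _; rewrite mx0 mulrA.
pose D4 := \prod_(i : V * V | N i.1 i.2) wX i.1 i.2.
have D4n : evp t0 D4 != 0.
  rewrite rmorph_prod; apply/prodf_neq0 => -[u v] /= euv.
  by rewrite wX0 mulf_neq0 // w_neq0.
have [|D5 D5n D5P] := @ker_le2_open _ _ (evp t0) _ _ (stress_mx true wX lX).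
  by exists (fun u => t0 (u, 0)), (fun u => t0 (u, 1)) => h /kerE/ker1.
have [|D6 D6n D6P] := @ker_le2_open _ _ (evp t0) _ _ (stress_mx false wX lX).
  by exists (fun=> 1), (fun u => t0 (u, 2)) => h /kerE/ker0.
exists (nondeg X a b c * D2 * D3 * D4 * D5 * D6).
  rewrite 5!rmorphM /= ndE.
  have nd3 := mulf_neq0 (mulf_neq0 nd D2n) D3n.
  exact: mulf_neq0 (mulf_neq0 (mulf_neq0 nd3 D4n) D5n) D6n.
move=> K t; rewrite 5!rmorphM /= ndE 5!mulf_eq0 5!negb_or.
move=> /andP[/andP[/andP[/andP[/andP[tnd tD2] tD3] tD4] tD5] tD6].
split.
- by exists a, b, c.
- move=> h.
  apply: ker_span2; [exact: D2P tD2|exact: rotation_in_ker|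
    exact: translation_in_ker|exact: trivial_motions_indep tnd].
exists (fun u v => evp t (wX u v)), (evp t \o lX).
have st := stressP _ _ tD3 tnd.
have mxE' bb : (fun u v => evp t (stress_mx bb wX lX u v)) =
    stress_mx bb (fun u v => evp t (wX u v)) (evp t \o lX).
  by apply/funext => u; apply/funext => v; rewrite rmorph_stress_mx.
have [m1 m0] := stress_ker_indep tnd.
have [_ _ st_eq] := st.
split; first exact: st.
  move=> u v euv; apply: contraNneq tD4 => w0'.
  by rewrite rmorph_prod (bigD1 (u, v)) //= w0' mul0r.
split=> h.
  apply: ker_span2; [|exact: (st_eq 0)|exact: (st_eq 1)|exact: m1].
  by rewrite -mxE'; exact: D5P tD5.
apply: ker_span2; [|exact: constant_in_ker|exact: (st_eq 2)|exact: m0].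
by rewrite -mxE'; exact: D6P tD6.
Qed.

End Openness.

(** * Edge additions and 1-extensions *)

Lemma poly_nonroot (F : numFieldType) (p : {poly F}) : p != 0 ->
  exists s, p.[s] != 0.
Proof.
move=> p0; apply: contrapT => no.
have roots : all (root p) [seq n%:R | n <- iota 0 (size p)].
  apply/allP => s _; apply/rootP; apply: contra_notP no => /eqP ps.
  by exists s.
have := max_poly_roots p0 roots.
rewrite map_inj_uniq ?iota_uniq; last exact: (mulrIn (oner_neq0 F)).
by rewrite size_map size_iota ltnn => /(_ isT).
Qed.

Lemma mpoly_rmorph_ext (T B : comNzRingType) (n : nat)
    (f g : {rmorphism {mpoly T[n]} -> B}) :
  (forall c, f c%:MP = g c%:MP) -> (forall i, f 'X_i = g 'X_i) -> f =1 g.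
Proof.
move=> fgC fgX P; rewrite (mpolyE P) !rmorph_sum; apply: eq_bigr => m _.
rewrite -mul_mpolyC !rmorphM fgC; congr (_ * _).
rewrite mpolyXE_id !rmorph_prod; apply: eq_bigr => i _.
by rewrite !rmorphXn /= fgX.
Qed.

(* Restrict both polynomials to the line through [a] and [b]. *)
Lemma common_nonzero (J : finType) (D H : {mpoly rat[#|J|]}) (a b : J -> rat) :
  evp a D != 0 -> evp b H != 0 -> exists c : J -> rat, evp c D != 0 /\ evp c H != 0.
Proof.
move=> aD bH.
pose pt s j := a j + s * (b j - a j).
pose L : {rmorphism {mpoly rat[#|J|]} -> {poly rat}} :=
  mmap polyC (fun k =>
    (a (enum_val k))%:P + 'X * (b (enum_val k) - a (enum_val k))%:P).
have LE s P : (L P).[s] = evp (pt s) P.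
  apply: (@mpoly_rmorph_ext _ _ _ (horner_eval s \o L) (evp (pt s))) => [c|i] /=.
    by rewrite evpC /L /= mmapC /horner_eval hornerC ratr_rat.
  have -> : evp (pt s) 'X_i = pt s (enum_val i).
    by rewrite -[in 'X_i](enum_valK i) (evpX (pt s)).
  by rewrite /L /= mmapX mmap1U /horner_eval !hornerE.
have pt0 : pt 0 = a by apply/funext => j; rewrite /pt mul0r addr0.
have pt1 : pt 1 = b by apply/funext => j; rewrite /pt mul1r addrC subrK.
have LD : L D != 0.
  by apply: contraNneq aD => L0; rewrite -pt0 -LE L0 horner0.
have LH : L H != 0.
  by apply: contraNneq bH => L0; rewrite -pt1 -LE L0 horner0.
have [s] := poly_nonroot (mulf_neq0 LD LH).
rewrite hornerM mulf_eq0 negb_or !LE => /andP[sD sH].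
exists (pt s); split; [exact: sD|exact: sH].
Qed.

Section Perturbation.
Variables (K : numFieldType) (V : finType).

(** At [s = 0] the combination is the first stress, of maximal rank. The minors that witness this
    are polynomials in [s], and [P] is their product. *)
Lemma max_rank_perturb (e : rel V) (t : V * 'I_3 -> K) w l w' l' a b c :
  nondeg t a b c != 0 -> is_stress e t w l -> max_rank t w l ->
  is_stress e t w' l' ->
  exists2 P : {poly K}, P != 0 & forall s, P.[s] != 0 ->
    is_stress e t (fun u v => w u v + s * w' u v) (fun u => l u + s * l' u) /\
    max_rank t (fun u v => w u v + s * w' u v) (fun u => l u + s * l' u).
Proof.
move=> nd [w_sym w_supp w_eq] [ker1 ker0] [w'_sym w'_supp w'_eq].
pose wX u v := (w u v)%:P + 'X * (w' u v)%:P.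
pose lX u := (l u)%:P + 'X * (l' u)%:P.
have evE s : (fun u v => (wX u v).[s]) = (fun u v => w u v + s * w' u v).
  by apply/funext => u; apply/funext => v; rewrite /wX !hornerE.
have evlE s : (fun u => (lX u).[s]) = (fun u => l u + s * l' u).
  by apply/funext => u; rewrite /lX !hornerE.
have mxE' s bb : (fun u v => horner_eval s (stress_mx bb wX lX u v)) =
    stress_mx bb (fun u v => w u v + s * w' u v) (fun u => l u + s * l' u).
  apply/funext => u; apply/funext => v.
  by rewrite rmorph_stress_mx -evE -evlE.
have st s : is_stress e t (fun u v => w u v + s * w' u v) (fun u => l u + s * l' u).
  split=> [u v|u v euv|k u]; first by rewrite w_sym w'_sym.
    by rewrite w_supp // w'_supp // mulr0 addr0.
  rewrite stress_mx_sum /=.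
  have := w_eq k u; have := w'_eq k u; rewrite !stress_mx_sum.
  set E' := _ + _; set E := _ + _ => E'0 E0.
  transitivity (E + s * E'); last by rewrite E0 E'0 mulr0 addr0.
  rewrite /E /E' [s * (_ + _)]mulrDr mulr_sumr addrACA -big_split /=.
  by congr (_ + _); [apply: eq_bigr => v _|]; ring.
have mx0 bb : (fun u v => horner_eval 0 (stress_mx bb wX lX u v)) = stress_mx bb w l.
  rewrite mxE'; congr (stress_mx bb _ _); apply/funext => u.
    by apply/funext => v; rewrite mul0r addr0.
  by rewrite mul0r addr0.
have [|d1 d1n d1P] := @ker_le2_open _ _ (horner_eval 0) _ _ (stress_mx true wX lX).
  by rewrite mx0; exists (fun u => t (u, 0)), (fun u => t (u, 1)) => h /ker1.
have [|d2 d2n d2P] := @ker_le2_open _ _ (horner_eval 0) _ _ (stress_mx false wX lX).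
  by rewrite mx0; exists (fun=> 1), (fun u => t (u, 2)) => h /ker0.
have n0 d : horner_eval (0 : K) d != 0 -> d != 0.
  by apply: contraNneq => ->; rewrite rmorph0.
exists (d1 * d2); first by rewrite mulf_neq0 ?n0.
move=> s; rewrite hornerM mulf_eq0 negb_or => /andP[s1 s2].
split; first exact: st.
have [m1 m0] := stress_ker_indep nd; have [_ _ st_eq] := st s.
split=> h.
  apply: ker_span2; [|exact: (st_eq 0)|exact: (st_eq 1)|exact: m1].
  by rewrite -mxE'; exact: (d1P _ (horner_eval s) s1).
apply: ker_span2; [|exact: constant_in_ker|exact: (st_eq 2)|exact: m0].
by rewrite -mxE'; exact: (d2P _ (horner_eval s) s2).
Qed.

Lemma in_ker_rig_row_sub (e e' : rel V) (t : V * 'I_3 -> K) h :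
  subrel e e' -> in_ker (rig_row e' t) h -> in_ker (rig_row e t) h.
Proof.
move=> ee' he [u|[u v]].
  by have := he (inl u); rewrite !rig_row_sum.
have := he (inr (u, v)); rewrite !rig_row_sum.
by case: (boolP (e u v)) => [/ee' ->|_] //; rewrite mul0r.
Qed.

(* By rigidity the row of the new edge is a combination of the rows of the old
   ones, which is a second stress; it is added with a generic coefficient. *)
Lemma good_add_edge (e : rel V) (t : V * 'I_3 -> K) a b :
  symmetric e -> a != b -> ~~ e a b -> good e e t ->
  good (fun u v => e u v || ((u, v) \in [:: (a, b); (b, a)]))
       (fun u v => e u v || ((u, v) \in [:: (a, b); (b, a)])) t.
Proof.
move=> e_sym ab eab [[x [y [z nd]]] rig [w [l [st w_neq0 rk]]]].
set e' := fun u v => _.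
split; first by exists x, y, z.
  by move=> h hk; apply: rig; apply: in_ker_rig_row_sub hk => u v; rewrite /e' => ->.
(* The row of the new edge, formed with the full relation because [e] would make it zero. *)
pose r := rig_row (fun _ _ => true) t (inr (a, b)).
have [W WE] : exists W, forall j, r j = \sum_i W i * rig_row e t i j.
  apply: row_span => h /rig[s1 [s2 hE]].
  transitivity (s1 * (\sum_j r j * rotation t j) +
                s2 * (\sum_j r j * translation K j)).
    rewrite !mulr_sumr -big_split /=; apply: eq_bigr => j _.
    by rewrite hE; ring.
  by rewrite rotation_in_ker translation_in_ker !mulr0 addr0.
pose ind u v : K := ((u, v) \in [:: (a, b); (b, a)])%:R.
have indE u v : ind u v = (u == a)%:R * (v == b)%:R + (u == b)%:R * (v == a)%:R.
  rewrite /ind !inE !xpair_eqE; have ba : b != a by rewrite eq_sym.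
  case: (eqVneq u a) => [->|_]; rewrite ?(negPf ab) /=;
    by case: eqP => _ /=; case: eqP => _ /=; ring.
(* Weight 1 on the new edge, minus the combination of old rows that equals its row. *)
pose w' u v : K := ind u v - (e u v)%:R * (W (inr (u, v)) + W (inr (v, u))).
pose l' u := - W (inl u).
have st' : is_stress e' t w' l'.
  split.
  - by move=> u v; rewrite /w' e_sym [W _ + _]addrC !indE addrC; congr (_ - _); ring.
  - move=> u v; rewrite /e' negb_or => /andP[/negPf euv /negPf uv].
    by rewrite /w' /ind euv uv mul0r subr0.
  move=> k u; rewrite stress_mx_sum.
  have := WE (u, k); rewrite rig_col_sum //.
  rewrite (stress_mx_sum _ _ _ (fun v => t (v, k))).
  rewrite /r /= mul1r => rE.
  transitivity (\sum_v ind u v * (t (u, k) - t (v, k)) -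
    (t (a, k) - t (b, k)) * ((u == a)%:R - (u == b)%:R)).
    rewrite rE opprD addrA -sumrB; congr (_ + _); last by rewrite /l'; ring.
    by apply: eq_bigr => v _; rewrite /w'; ring.
  transitivity ((u == a)%:R * (\sum_v (v == b)%:R * (t (u, k) - t (v, k))) +
    (u == b)%:R * (\sum_v (v == a)%:R * (t (u, k) - t (v, k))) -
    (t (a, k) - t (b, k)) * ((u == a)%:R - (u == b)%:R)).
    congr (_ - _); rewrite !mulr_sumr -big_split /=.
    by apply: eq_bigr => v _; rewrite indE; ring.
  rewrite !(sum_delta (fun v => t (u, k) - t (v, k))).
  case: (eqVneq u a) => [->|_]; rewrite ?(negPf ab) /=; first by ring.
  by case: eqP => [->|_] /=; ring.
have st1 : is_stress e' t w l.
  case: st => w_sym w_supp w_eq; split=> // u v.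
  by rewrite /e' negb_or => /andP[/w_supp].
have [P P0 PP] := max_rank_perturb nd st1 rk st'.
(* A factor for an old edge is nonzero at 0; for the new edge [w] is 0 and [w'] is 1, so the factor
   is the variable itself. *)
pose Q := \prod_(i : V * V | e' i.1 i.2) ((w i.1 i.2)%:P + 'X * (w' i.1 i.2)%:P).
have Q0 : Q != 0.
  apply/prodf_neq0 => -[u v]; rewrite /e' /=.
  case: (boolP (e u v)) => [euv _|euv /= uv].
    apply: contraNneq (w_neq0 _ _ euv) => /(congr1 (horner^~ 0)).
    by rewrite !hornerE => ->.
  have -> : w u v = 0 by case: st => _ w_supp _; rewrite w_supp.
  by rewrite /w' /ind uv (negPf euv) mul0r subr0 add0r mulr1 polyX_eq0.
have [s] := poly_nonroot (mulf_neq0 P0 Q0).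
rewrite hornerM mulf_eq0 negb_or => /andP[/PP[sts rks] sQ].
exists (fun u v => w u v + s * w' u v), (fun u => l u + s * l' u).
split; [exact: sts| |exact: rks].
move=> u v euv; apply: contraNneq sQ => wuv.
by rewrite /Q (bigD1 (u, v)) //= hornerM !hornerE wuv mul0r.
Qed.

End Perturbation.

(** An explicit expansion, which [ring] handles directly. *)
Definition det3 (S : comNzRingType) (r1 r2 r3 : 'I_3 -> S) : S :=
  r1 0 * (r2 1 * r3 2 - r2 2 * r3 1) - r1 1 * (r2 0 * r3 2 - r2 2 * r3 0)
  + r1 2 * (r2 0 * r3 1 - r2 1 * r3 0).

Lemma det3_left (K : fieldType) (r1 r2 r3 : 'I_3 -> K) x y z :
  det3 r1 r2 r3 != 0 -> (forall k, x * r1 k + y * r2 k + z * r3 k = 0) -> x = 0.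
Proof.
move=> d0 E; apply: (mulIf d0); rewrite mul0r /det3.
transitivity ((x * r1 0 + y * r2 0 + z * r3 0) * (r2 1 * r3 2 - r2 2 * r3 1)
  - (x * r1 1 + y * r2 1 + z * r3 1) * (r2 0 * r3 2 - r2 2 * r3 0)
  + (x * r1 2 + y * r2 2 + z * r3 2) * (r2 0 * r3 1 - r2 1 * r3 0)).
  by ring.
by rewrite !E; ring.
Qed.

Lemma det3_right (K : fieldType) (r1 r2 r3 x : 'I_3 -> K) :
  det3 r1 r2 r3 != 0 -> \sum_k r1 k * x k = 0 -> \sum_k r2 k * x k = 0 ->
  \sum_k r3 k * x k = 0 -> forall k, x k = 0.
Proof.
rewrite !sum3 => d0 E1 E2 E3 k; apply: (mulfI d0); rewrite mulr0 /det3.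
set e1 := _ + _ in E1; set e2 := _ + _ in E2; set e3 := _ + _ in E3.
case: (ord3P k) => ->.
- transitivity (e1 * (r2 1 * r3 2 - r2 2 * r3 1) - e2 * (r1 1 * r3 2 - r1 2 * r3 1)
    + e3 * (r1 1 * r2 2 - r1 2 * r2 1)); first by rewrite /e1 /e2 /e3; ring.
  by rewrite E1 E2 E3; ring.
- transitivity (- e1 * (r2 0 * r3 2 - r2 2 * r3 0) + e2 * (r1 0 * r3 2 - r1 2 * r3 0)
    - e3 * (r1 0 * r2 2 - r1 2 * r2 0)); first by rewrite /e1 /e2 /e3; ring.
  by rewrite E1 E2 E3; ring.
transitivity (e1 * (r2 0 * r3 1 - r2 1 * r3 0) - e2 * (r1 0 * r3 1 - r1 1 * r3 0)
    + e3 * (r1 0 * r2 1 - r1 1 * r2 0)); first by rewrite /e1 /e2 /e3; ring.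
by rewrite E1 E2 E3; ring.
Qed.

Lemma rmorph_det3 (S S' : comNzRingType) (f : {rmorphism S -> S'}) r1 r2 r3 :
  f (det3 r1 r2 r3) = det3 (f \o r1) (f \o r2) (f \o r3).
Proof. by rewrite /det3 !(rmorphD, rmorphM, rmorphN). Qed.

Lemma set2_eq (T : finType) (x y a b : T) :
  ([set x; y] == [set a; b]) = ((x, y) \in [:: (a, b); (b, a)]).
Proof.
rewrite !inE !xpair_eqE; apply/eqP/orP => [E|[]/andP[/eqP-> /eqP->]] //; last first.
  by rewrite setUC.
have /set2P hx : x \in [set a; b] by rewrite -E set21.
have /set2P hy : y \in [set a; b] by rewrite -E set22.
have /set2P ha : a \in [set x; y] by rewrite E set21.
have /set2P hb : b \in [set x; y] by rewrite E set22.
case: (eqVneq x a) => [xa|/eqP xa]; [left|right]; rewrite ?eqxx /=;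
  by repeat (apply/andP; split); apply/eqP; intuition congruence.
Qed.

Lemma sum_option (T : nmodType) (V : finType) (F : option V -> T) :
  \sum_x F x = F None + \sum_v F (Some v).
Proof.
rewrite (bigD1 None) //=; congr (_ + _).
rewrite (reindex_omap Some id) /=; last by case.
by apply: eq_bigl => v; rewrite eqxx.
Qed.

(** * The 1-extension: midpoint position, then a perturbation *)

Section OneExtension.
Variables (G : sgraph) (a b c : G).
Hypotheses (ab : adj a b) (ca : c != a) (cb : c != b).

Let ext := one_extension_rel a b c.
(** The edges that carry weight in the midpoint position: all but the one from the new vertex to
    [c]. *)
Let ext_strong x y := ext x y && ((x, y) \notin [:: (None, Some c); (Some c, None)]).

Definition midpoint_ext (t : G * 'I_3 -> rat) (j : option G * 'I_3) : rat :=
  match j.1 with Some v => t (v, j.2) | None => (t (a, j.2) + t (b, j.2)) / 2 end.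

(* Up to a factor 8, [new_vertex_det (midpoint_ext t)] with [c] in place of [b]. *)
Definition midpoint_det (S : comNzRingType) (t : G * 'I_3 -> S) : S :=
  det3 (fun k => t (b, k) - t (a, k)) (fun k => t (a, k) + t (b, k) - 2 * t (c, k))
       (fun k => (planar k)%:R * (t (a, k) + t (b, k))).

(** The rows are the directions of the forces on the new vertex once the edge to [c] is
    weightless. *)
Definition new_vertex_det (S : comNzRingType) (t : option G * 'I_3 -> S) : S :=
  det3 (fun k => t (None, k) - t (Some a, k)) (fun k => t (None, k) - t (Some b, k))
       (fun k => (planar k)%:R * t (None, k)).

Let extE u v :
  ext (Some u) (Some v) = adj u v && ((u, v) \notin [:: (a, b); (b, a)]).
Proof. by rewrite /ext /= /delete_edge_rel set2_eq. Qed.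

Let aNb : a != b.
Proof. by apply: contraTneq ab => ->; rewrite adj_irr. Qed.

(** The equations of the two collinear half-edges add up to that of the deleted edge, so the motion
    is trivial on the old vertices. Subtracting the trivial motion leaves three independent
    conditions at the new vertex: a half-edge, the edge to [c] and the radius. *)
Lemma midpoint_rigid t : midpoint_det t != 0 -> rigid (@adj G) t ->
  rigid ext (midpoint_ext t).
Proof.
move=> det0 rig h hk.
pose n k := (t (a, k) + t (b, k)) / 2.
have edge v : v \in [set a; b; c] ->
    \sum_k (n k - t (v, k)) * (h (None, k) - h (Some v, k)) = 0.
  move=> vabc; have := hk (inr (None, Some v)).
  by rewrite rig_row_sum /ext /= vabc mul1r.
have Ea := edge a; rewrite !inE eqxx /= in Ea; have {}Ea := Ea isT.
have Eb := edge b; rewrite !inE eqxx orbT /= in Eb; have {}Eb := Eb isT.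
have Ec := edge c; rewrite !inE eqxx orbT /= in Ec; have {}Ec := Ec isT.
have E0 : n 0 * h (None, 0) + n 1 * h (None, 1) = 0.
  by have := hk (inl None); rewrite rig_row_sum.
have Eab : \sum_k (t (a, k) - t (b, k)) * (h (Some a, k) - h (Some b, k)) = 0.
  move: Ea Eb; rewrite /n !sum3 => Ea Eb; lra.
have /rig[s1 [s2 hE]] : in_ker (rig_row (@adj G) t) (fun j => h (Some j.1, j.2)).
  move=> [u|[u v]]; rewrite rig_row_sum /=.
    by have := hk (inl (Some u)); rewrite rig_row_sum.
  case: (boolP (adj u v)) => [uv|_]; last by rewrite mul0r.
  rewrite mul1r; case: (boolP ((u, v) \in [:: (a, b); (b, a)])) => [|uvab].
    rewrite !inE !xpair_eqE => /orP[]/andP[/eqP -> /eqP ->] //.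
    by rewrite -[RHS]Eab; apply: eq_bigr => k _; ring.
  have := hk (inr (Some u, Some v)).
  by rewrite rig_row_sum extE uv uvab mul1r.
have hE' u k : h (Some u, k) = s1 * rotation t (u, k) + s2 * translation _ (u, k).
  by have := hE (u, k).
pose g k := h (None, k) - (s1 * rotation (midpoint_ext t) (None, k) +
                           s2 * translation _ (None : option G, k)).
suff g0 k : g k = 0.
  exists s1, s2 => -[[u|] k]; first exact: hE'.
  by apply/eqP; rewrite -subr_eq0; apply/eqP/g0.
move: Ea Ec E0; rewrite !sum3 !hE' /n /rotation /translation /= => Ea Ec E0.
apply: (det3_right det0);
  rewrite sum3 /g /rotation /translation /midpoint_ext /planar /=.
- set z := _ + _ in Ea; transitivity (2 * z); last by rewrite Ea mulr0.
  by rewrite /z; field.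
- set z := _ + _ in Ec; transitivity (2 * z); last by rewrite Ec mulr0.
  by rewrite /z; field.
set z := _ + _ in E0; transitivity (2 * z); last by rewrite E0 mulr0.
by rewrite /z; field.
Qed.

Section Stress.
Variables (w : G -> G -> rat) (l : G -> rat).

(** Springs in series: an edge of weight [w a b] cut at its midpoint becomes two edges of weight
    [2 * w a b]. The edge to [c] gets weight 0. *)
Definition split_weight (x y : option G) : rat :=
  match x, y with
  | Some u, Some v => if (u, v) \in [:: (a, b); (b, a)] then 0 else w u v
  | Some v, None | None, Some v => ((v == a)%:R + (v == b)%:R) * (2 * w a b)
  | None, None => 0
  end.

Definition split_radial (x : option G) : rat := if x is Some u then l u else 0.

Hypothesis w_sym : forall u v, w u v = w v u.

Lemma split_None bb h :
  \sum_y stress_mx bb split_weight split_radial None y * h y =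
  2 * w a b * (2 * h None - h (Some a) - h (Some b)).
Proof.
rewrite stress_mx_sum sum_option /= mul0r add0r mulr0 mul0r addr0.
transitivity (2 * w a b *
  (\sum_v (v == a)%:R * (h None - h (Some v)) +
   \sum_v (v == b)%:R * (h None - h (Some v)))).
  rewrite -big_split mulr_sumr /=; apply: eq_bigr => v _; ring.
rewrite !(sum_delta (fun v => h None - h (Some v))); ring.
Qed.

Lemma split_Some bb h u : 2 * h None = h (Some a) + h (Some b) ->
  \sum_y stress_mx bb split_weight split_radial (Some u) y * h y =
  \sum_v stress_mx bb w l u v * h (Some v).
Proof.
move=> h0; rewrite !(stress_mx_sum _ _ _ h) (stress_mx_sum _ _ _ (h \o Some)).
rewrite sum_option /=; congr (_ + _); rewrite addrC.
have -> : \sum_v w u v * (h (Some u) - h (Some v)) =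
    \sum_v (if (u, v) \in [:: (a, b); (b, a)] then 0 else w u v) *
      (h (Some u) - h (Some v)) +
    ((u == a)%:R * (\sum_v (v == b)%:R * (w u v * (h (Some u) - h (Some v)))) +
     (u == b)%:R * (\sum_v (v == a)%:R * (w u v * (h (Some u) - h (Some v))))).
  rewrite !mulr_sumr -!big_split /=; apply: eq_bigr => v _.
  rewrite !inE !xpair_eqE; have ba : b != a by rewrite eq_sym.
  case: (eqVneq u a) => [->|_]; rewrite ?(negPf aNb) /=.
    by case: eqP => _ /=; ring.
  by case: eqP => _ /=; case: eqP => _ /=; ring.
congr (_ + _).
rewrite !(sum_delta (fun v => w u v * (h (Some u) - h (Some v)))).
case: (eqVneq u a) => [->|_]; rewrite ?(negPf aNb) /=.
  have -> : h (Some b) = 2 * h None - h (Some a) by rewrite h0; ring.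
  by ring.
case: eqP => [->|_] /=; last by ring.
have -> : h (Some a) = 2 * h None - h (Some b) by rewrite h0; ring.
by rewrite [w b a]w_sym; ring.
Qed.

Hypothesis wab : w a b != 0.

(** The row of the new vertex puts [h None] at the mean of the values at [a] and [b], and then the
    other rows are those of the old stress. Equilibrium and maximal rank both follow from this. *)
Lemma split_ker bb h : in_ker (stress_mx bb split_weight split_radial) h <->
  2 * h None = h (Some a) + h (Some b) /\ in_ker (stress_mx bb w l) (h \o Some).
Proof.
have w2 : 2 * w a b != 0 by rewrite mulf_neq0.
split=> [hk|[h0 hk]].
  have h0 : 2 * h None = h (Some a) + h (Some b).
    have /eqP := hk None; rewrite split_None mulf_eq0 (negPf w2) /= => /eqP E.
    by apply/eqP; rewrite -subr_eq0 opprD addrA E.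
  by split=> // u; have := hk (Some u); rewrite split_Some.
case=> [u|]; first by rewrite split_Some //; apply: hk.
by rewrite split_None h0; ring.
Qed.

End Stress.

Lemma midpoint_good t : midpoint_det t != 0 -> good (@adj G) (@adj G) t ->
  good ext ext_strong (midpoint_ext t).
Proof.
move=> det0 [[x [y [z nd]]] rig [w [l [[w_sym w_supp w_eq] w_neq0 [ker1 ker0]]]]].
have wab : w a b != 0 by apply: w_neq0.
split; [by exists (Some x), (Some y), (Some z)|exact: midpoint_rigid|].
have avg k : 2 * midpoint_ext t (None, k) = t (a, k) + t (b, k).
  by rewrite /midpoint_ext /=; field.
exists (split_weight w), (split_radial l); split.
- split.
  + move=> [u|] [v|] //=.
    have -> : ((u, v) \in [:: (a, b); (b, a)]) = ((v, u) \in [:: (a, b); (b, a)]).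
      by rewrite -!set2_eq setUC.
    by rewrite w_sym.
  + move=> [u|] [v|] //.
    * rewrite extE negb_and negbK /= => /orP[/w_supp ->|->] //.
      by case: ifP.
    * rewrite /ext /= !inE !negb_or => /andP[/andP[/negPf -> /negPf ->] _].
      by rewrite addr0 mul0r.
    * rewrite /ext /= !inE !negb_or => /andP[/andP[/negPf -> /negPf ->] _].
      by rewrite addr0 mul0r.
  + by move=> k; apply/split_ker => //; split=> //; apply: w_eq.
- move=> [u|] [v|]; rewrite /ext_strong.
  + by rewrite extE /= => /andP[/andP[uv /negPf ->] _]; apply: w_neq0.
  + rewrite /ext /= !inE !xpair_eqE /= => /andP[uabc uc].
    have : (u == a) || (u == b).
      move: uabc uc; rewrite ?(inj_eq Some_inj).
      by case: eqP => //= _; case: eqP => //= _ ->.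
    case: (eqVneq u a) => [->|_] /=.
      by rewrite (negPf aNb) addr0 mul1r mulf_neq0.
    by move=> ->; rewrite add0r mul1r mulf_neq0.
  + rewrite /ext /= !inE !xpair_eqE /= => /andP[uabc uc].
    have : (v == a) || (v == b).
      move: uabc uc; rewrite ?(inj_eq Some_inj).
      by case: eqP => //= _; case: eqP => //= _ ->.
    case: (eqVneq v a) => [->|_] /=.
      by rewrite (negPf aNb) addr0 mul1r mulf_neq0.
    by move=> ->; rewrite add0r mul1r mulf_neq0.
  + by [].
split=> h /split_ker-/(_ w_sym wab)[h0 hk].
  have [s1 [s2 hE]] := ker1 _ hk; exists s1, s2 => -[u|]; first exact: hE.
  have := avg 0; have := avg 1; have := hE a; have := hE b => /=; move: h0.
  set p0 := midpoint_ext t (None, 0); set p1 := midpoint_ext t (None, 1).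
  move=> h0 hb ha A1 A0; apply: (@mulfI _ 2) => //.
  by rewrite h0 ha hb mulrDr !mulrA ![2 * _]mulrC -!mulrA A0 A1; ring.
have [s1 [s2 hE]] := ker0 _ hk; exists s1, s2 => -[u|]; first exact: hE.
have := avg 2; have := hE a; have := hE b => /=; move: h0.
set p2 := midpoint_ext t (None, 2).
move=> h0 hb ha A2; apply: (@mulfI _ 2) => //.
by rewrite h0 ha hb mulrDr !mulrA ![2 * _]mulrC -!mulrA A2; ring.
Qed.

Lemma evp_midpoint_det (t : G * 'I_3 -> rat) :
  evp t (midpoint_det (Xvar (J := (G * 'I_3)%type))) = midpoint_det t.
Proof.
rewrite rmorph_det3; congr det3; apply/funext => k /=;
  by rewrite !(rmorphB, rmorphD, rmorphM, rmorph_nat) /= !evpX ?rmorph1.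
Qed.

Lemma evp_new_vertex_det (t : option G * 'I_3 -> rat) :
  evp t (new_vertex_det (Xvar (J := (option G * 'I_3)%type))) = new_vertex_det t.
Proof.
rewrite rmorph_det3; congr det3; apply/funext => k /=;
  by rewrite !(rmorphB, rmorphM, rmorph_nat) /= !evpX.
Qed.

Lemma ext_sym : symmetric ext.
Proof. exact: one_extension_sym. Qed.

(* If the weight of the edge from the new vertex to [c] vanished, equilibrium
   there would be a relation between the two other edges and the radius. *)
Lemma good_new_edge (t : option G * 'I_3 -> rat) : new_vertex_det t != 0 ->
  good ext ext_strong t -> good ext ext t.
Proof.
move=> det0 [nd rig [w [l [st w_neq0 rk]]]]; split=> //.
exists w, l; split=> // x y xy.
case: (boolP ((x, y) \in [:: (None, Some c); (Some c, None)])) => xyc; last first.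
  by apply: w_neq0; rewrite /ext_strong xy.
have [w_sym w_supp w_eq] := st.
suff : w None (Some c) != 0.
  move: xyc; rewrite !inE !xpair_eqE => /orP[]/andP[/eqP-> /eqP->] //.
  by rewrite w_sym.
apply/negP => /eqP wc0.
have /negP[] : w None (Some a) != 0.
  apply: w_neq0; rewrite /ext_strong /ext /= !inE eqxx /= xpair_eqE /=.
  by rewrite !xpair_eqE /= orbF (inj_eq Some_inj) eq_sym.
apply/eqP/(det3_left det0 (y := w None (Some b)) (z := l None)) => k.
have := w_eq k None; rewrite (stress_mx_sum _ _ _ (fun v => t (v, k))) sum_option.
rewrite subrr mulr0 add0r (bigD1 a) //= (bigD1 b) /=; last by rewrite eq_sym.
rewrite big1 ?addr0 => [<-|v /andP[va vb]]; first by ring.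
case: (eqVneq v c) => [->|vc]; first by rewrite wc0 mul0r.
by rewrite w_supp ?mul0r // /ext /= !inE !negb_or va vb vc.
Qed.

(** Two moves inside open sets where [good] persists: the old framework is moved to make
    [midpoint_det] nonzero, and after insertion of the midpoint the whole framework is moved to make
    [new_vertex_det] nonzero. *)
Lemma good_one_extension (t : G * 'I_3 -> rat) : good (@adj G) (@adj G) t ->
  exists t' : option G * 'I_3 -> rat, good ext ext t'.
Proof.
move=> gt; have [D tD DP] := good_open (@adj_sym G) gt.
(* With [a] at (1, -1, 0), [b] at (1, 1, 0) and [c] at (0, 0, 1) the determinant is -8. *)
pose p0 (j : G * 'I_3) : rat :=
  if j.1 == a then (if j.2 == 0 then 1 else if j.2 == 1 then - 1 else 0)
  else if j.1 == b then (if j.2 == 2 then 0 else 1)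
  else (j.2 == 2)%:R.
have p0n : evp p0 (midpoint_det (Xvar (J := (G * 'I_3)%type))) != 0.
  rewrite evp_midpoint_det /midpoint_det /det3 /p0 /planar /= !eqxx.
  by rewrite (negPf ca) (negPf cb) [b == a]eq_sym (negPf aNb).
have [t1 [t1D t1n]] := common_nonzero tD p0n.
have m0 : midpoint_det t1 != 0 by rewrite -evp_midpoint_det; exact: t1n.
have g1 := midpoint_good m0 (DP _ _ t1D).
have [D' tD' DP'] := good_open ext_sym g1.
(* Here the three rows of the determinant are distinct unit vectors. *)
pose q0 (j : option G * 'I_3) : rat :=
  match j.1 with
  | None => (j.2 == 0)%:R
  | Some v => if v == a then (if j.2 == 0 then 1 else if j.2 == 1 then - 1 else 0)
      else if j.2 == 0 then 1 else if j.2 == 1 then 0 else - 1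
  end.
have q0n : evp q0 (new_vertex_det (Xvar (J := (option G * 'I_3)%type))) != 0.
  rewrite evp_new_vertex_det /new_vertex_det /det3 /q0 /planar /= !eqxx.
  by rewrite [b == a]eq_sym (negPf aNb).
have [t2 [t2D t2n]] := common_nonzero tD' q0n.
exists t2; apply: good_new_edge; last exact: DP' t2D.
by rewrite -evp_new_vertex_det; exact: t2n.
Qed.

End OneExtension.

Lemma good_iso (K : fieldType) (V V' : finType) (e : rel V) (e' : rel V')
    (f : V -> V') (t : V' * 'I_3 -> K) :
  bijective f -> (forall x y, e' (f x) (f y) = e x y) ->
  good e e (fun j => t (f j.1, j.2)) -> good e' e' t.
Proof.
move=> bij_f ef [[a [b [c nd]]] rig [w [l [st w_neq0 [ker1 ker0]]]]].
have [w_sym w_supp w_eq] := st.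
have [g fK gK] := bij_f.
split; first by exists (f a), (f b), (f c).
  move=> h hk; have [|s1 [s2 hE]] := rig (fun j => h (f j.1, j.2)).
    case=> [u|[u v]].
      by have := hk (inl (f u)); rewrite !rig_row_sum.
    by have := hk (inr (f u, f v)); rewrite !rig_row_sum ef.
  exists s1, s2 => -[v k]; have := hE (g v, k); rewrite /= gK => ->.
  by rewrite /rotation /= gK.
pose w' x y := w (g x) (g y); pose l' x := l (g x).
have kerE bb h : in_ker (stress_mx bb w' l') h <->
    in_ker (stress_mx bb w l) (h \o f).
  have E u : \sum_y stress_mx bb w' l' (f u) y * h y =
             \sum_v stress_mx bb w l u v * h (f v).
    rewrite stress_mx_sum (stress_mx_sum _ _ _ (h \o f)) /l' /w' fK; congr (_ + _).
    rewrite (reindex f) /=; last exact: onW_bij.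
    by apply: eq_bigr => v _; rewrite fK.
  split=> hk u; first by rewrite -[RHS](hk (f u)) E.
  by rewrite -[u]gK E; apply: hk.
exists w', l'; split.
- split=> [u v|u v|k]; first exact: w_sym.
    by move=> e'uv; apply: w_supp; rewrite -ef !gK.
  exact/kerE/w_eq.
- by move=> u v uv; apply: w_neq0; rewrite -ef !gK.
split=> h /kerE hk.
  have [s1 [s2 hE]] := ker1 _ hk; exists s1, s2 => u.
  by rewrite -[u]gK; exact: hE.
have [s1 [s2 hE]] := ker0 _ hk; exists s1, s2 => u.
by rewrite -[u]gK; exact: hE.
Qed.

(** * Generic global rigidity *)

Section Transfer.
Variables (V : finType) (e : rel V).
Notation J := (V * 'I_3)%type.
Notation I := (V + V * V)%type.

Definition measurement (S : comNzRingType) (t : J -> S) (i : I) : S :=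
  match i with
  | inl u => t (u, 0) ^+ 2 + t (u, 1) ^+ 2
  | inr (u, v) => (e u v)%:R * \sum_k (t (u, k) - t (v, k)) ^+ 2
  end.

Lemma rmorph_measurement (S S' : comNzRingType) (f : {rmorphism S -> S'}) t i :
  f (measurement t i) = measurement (f \o t) i.
Proof.
case: i => [u|[u v]] /=; first by rewrite rmorphD !rmorphXn.
rewrite rmorphM rmorph_nat rmorph_sum; congr (_ * _).
by apply: eq_bigr => k _; rewrite rmorphXn rmorphB.
Qed.

Lemma der_measurement (S : comNzRingType) (K : fieldType)
    (phi : {rmorphism S -> K}) (D : S -> K) (t : J -> S) i :
  {morph D : a b / a + b} -> (forall a b, D (a * b) = phi a * D b + D a * phi b) ->
  D (measurement t i) = 2 * \sum_j rig_row e (phi \o t) i j * D (t j).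
Proof.
move=> Dadd Dmul.
have D0 : D 0 = 0 by apply: (@addIr _ (D 0)); rewrite add0r -Dadd addr0.
have DB a b : D (a - b) = D a - D b.
  by apply/eqP; rewrite eq_sym subr_eq -Dadd subrK.
rewrite (rig_row_sum e (phi \o t) i (D \o t)).
case: i => [u|[u v]] /=.
  by rewrite !expr2 Dadd !Dmul; ring.
case: (e u v); rewrite /= ?mul0r ?mulr0 ?D0 // !mul1r.
rewrite (big_morph D Dadd D0) mulr_sumr; apply: eq_bigr => k _.
by rewrite expr2 Dmul DB rmorphB; ring.
Qed.

Variable R : numFieldType.

(* Differentiation along [v] at [q] is a derivation of the ring generated over
   the rationals by the measurements of [p] (well defined because polynomial
   relations between those of the generic [p] are identities); it extends to the
   coordinates of [p], and [u] is made of their derivatives. *)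
Lemma variation_transfer (p q : J -> R) :
  (forall P : {mpoly rat[#|{: J}|]}, P != 0 -> evp p P != 0) ->
  (forall i, measurement q i = measurement p i) ->
  forall v, exists u, forall i,
    \sum_j rig_row e p i j * u j = \sum_j rig_row e q i j * v j.
Proof.
move=> gen eqm v.
(* The line through [q] in direction [v]. Along it [L] evaluates polynomials in the measurements and
   [M] polynomials in the coordinates; [C] expresses measurements by coordinates, whence
   [M (C F) = L F]. *)
pose line (j : J) : {poly R} := (q j)%:P + 'X * (v j)%:P.
pose f : {rmorphism rat -> {poly R}} := polyC \o @ratr R.
pose L : {rmorphism {mpoly rat[#|{: I}|]} -> {poly R}} :=
  mmap f (fun k => measurement line (enum_val k)).
pose M : {rmorphism {mpoly rat[#|{: J}|]} -> {poly R}} :=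
  mmap f (fun k => line (enum_val k)).
pose C : {rmorphism {mpoly rat[#|{: I}|]} -> {mpoly rat[#|{: J}|]}} :=
  mmap (@mpolyC _ rat) (fun k => measurement (@Xvar {: J}) (enum_val k)).
pose phi : {rmorphism {mpoly rat[#|{: I}|]} -> R} := horner_eval 0 \o L.
pose D F := ((L F)^`()).[0].
have Lvar (i : I) : L (Xvar i) = measurement line i.
  by rewrite /L /= /Xvar mmapX mmap1U enum_rankK.
have Cvar (i : I) : C (Xvar i) = measurement (@Xvar {: J}) i.
  by rewrite /C /= /Xvar mmapX mmap1U enum_rankK.
have Mvar : M \o (@Xvar {: J}) = line.
  by apply/funext => j; rewrite /M /= /Xvar mmapX mmap1U enum_rankK.
have line0 : horner_eval 0 \o line = q.
  by apply/funext => j /=; rewrite /horner_eval /line !hornerE.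
have phivar (i : I) : phi (Xvar i) = measurement p i.
  by rewrite /phi /= Lvar rmorph_measurement line0 eqm.
have evpC' F : evp p (C F) = phi F.
  apply: (@mpoly_rmorph_ext _ _ _ (evp p \o C) phi) => [c|k] /=.
    by rewrite /C /= mmapC evpC /phi /L /= mmapC /horner_eval hornerC.
  rewrite -[k]enum_valK -[RHS]/(phi (Xvar (enum_val k))) phivar Cvar.
  by rewrite rmorph_measurement evp_comp_Xvar.
have MC F : M (C F) = L F.
  apply: (@mpoly_rmorph_ext _ _ _ (M \o C) L) => [c|k] /=.
    by rewrite /C /= mmapC /M /L /= !mmapC.
  rewrite -[k]enum_valK -/(Xvar (enum_val k)) Cvar Lvar.
  by rewrite rmorph_measurement Mvar.
have derD : derivation_along phi D.
  split=> [F H|F H|F F0].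
  - by rewrite /D rmorphD derivD hornerD.
  - by rewrite /D rmorphM derivM !hornerE addrC.
  have CF0 : C F = 0.
    by apply/eqP/negPn/negP => /gen; rewrite evpC' F0 eqxx.
  by rewrite /D -MC CF0 rmorph0 deriv0 horner0.
have [B [psi [E [j [X [derE psij Ej psiX]]]]]] :=
  derivation_lift [seq p x | x <- enum {: J}] derD.
pose Y (x : J) := X (index x (enum {: J})).
have psiY : psi \o Y = p.
  apply/funext => x /=; have ltx : (index x (enum {: J}) < size (enum {: J}))%N.
    by rewrite index_mem mem_enum.
  rewrite psiX; first by rewrite (nth_map x) // nth_index // mem_enum.
  by rewrite size_map.
have [Eadd Emul Eker] := derE.
exists (E \o Y) => i; apply: (@mulfI _ 2); first by rewrite pnatr_eq0.
have := der_measurement Y i Eadd Emul; rewrite psiY => <-.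
have lineD : (fun x => (line x)^`().[0]) = v.
  by apply/funext => x; rewrite /line !derivE !hornerE.
have := @der_measurement _ _ (horner_eval (0 : R)) (fun F => F^`().[0]) line i.
rewrite line0 => Dm.
transitivity (D (Xvar i)); last first.
  rewrite /D Lvar Dm => [|F H|F H]; last by rewrite derivM !hornerE /= addrC.
    by rewrite -[in RHS]lineD.
  by rewrite derivD hornerD.
(* [measurement Y i] and [j (Xvar i)] have the same image under [psi], so [E] takes the same value
   on both. *)
rewrite -Ej; apply/eqP; rewrite -subr_eq0.
have EB a b : E (a - b) = E a - E b.
  by apply/eqP; rewrite eq_sym subr_eq -Eadd subrK.
by rewrite -EB Eker // rmorphB rmorph_measurement psiY psij phivar subrr.
Qed.

(** On a unit vector, [variation_transfer] writes a column of the Jacobian at [q] as a combination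
    of columns at [p], and the stress is orthogonal to all of these. *)
Lemma stress_transfer (p q : J -> R) w l : symmetric e ->
  (forall P : {mpoly rat[#|{: J}|]}, P != 0 -> evp p P != 0) ->
  (forall i, measurement q i = measurement p i) ->
  is_stress e p w l -> is_stress e q w l.
Proof.
move=> e_sym gen eqm [w_sym w_supp w_eq]; split=> // k u.
apply: (@mulfI _ 2); rewrite ?pnatr_eq0 // mulr0.
rewrite -(stress_covector_sum q l u k e_sym w_sym w_supp).
have [x xE] := variation_transfer gen eqm (fun j => (j == (u, k))%:R).
transitivity (\sum_i stress_covector w l i *
              \sum_j rig_row e q i j * (j == (u, k))%:R).
  apply: eq_bigr => i _; congr (_ * _); rewrite (bigD1 (u, k)) //= eqxx mulr1.
  by rewrite big1 ?addr0 // => j /negPf ->; rewrite mulr0.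
transitivity (\sum_i \sum_j stress_covector w l i * (rig_row e p i j * x j)).
  by apply: eq_bigr => i _; rewrite -xE mulr_sumr.
rewrite exchange_big big1 //= => -[u' k'] _.
transitivity ((\sum_i stress_covector w l i * rig_row e p i (u', k')) * x (u', k')).
  by rewrite mulr_suml; apply: eq_bigr => i _; rewrite mulrA.
by rewrite stress_covector_sum // w_eq mulr0 mul0r.
Qed.

(** A homogeneous Vandermonde determinant: the quadratic monomials at three points of the plane have
    determinant the product of the three minors. *)
Lemma quadratic_form_eq0 (p : J -> R) a b c A B C : nondeg p a b c != 0 ->
  (forall u,
    A * p (u, 0) ^+ 2 + B * (p (u, 0) * p (u, 1)) + C * p (u, 1) ^+ 2 = 0) ->
  [/\ A = 0, B = 0 & C = 0].
Proof.
rewrite /nondeg mulf_eq0 negb_or => /andP[nd _] Q.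
pose r u (k : 'I_3) := if k == 0 then p (u, 0) ^+ 2 else
  if k == 1 then p (u, 0) * p (u, 1) else p (u, 1) ^+ 2.
pose X (k : 'I_3) := if k == 0 then A else if k == 1 then B else C.
have X0 : forall k, X k = 0.
  apply: (@det3_right _ (r a) (r b) (r c)).
  - suff -> : det3 (r a) (r b) (r c) = minor p a b * minor p a c * minor p b c by [].
    by rewrite /det3 /r /minor /=; ring.
  - by rewrite sum3 -[RHS](Q a) /r /X /=; ring.
  - by rewrite sum3 -[RHS](Q b) /r /X /=; ring.
  by rewrite sum3 -[RHS](Q c) /r /X /=; ring.
by split; [exact: (X0 0)|exact: (X0 1)|exact: (X0 2)].
Qed.

(* Otherwise the heights themselves would be a nontrivial infinitesimal motion. *)
Lemma rigid_edge (p : J -> R) a b c : nondeg p a b c != 0 -> rigid e p ->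
  exists u v, e u v /\ p (u, 2) != p (v, 2).
Proof.
move=> nd rig; apply: contrapT => no.
have flat u v : e u v -> p (u, 2) = p (v, 2).
  by move=> uv; apply: contra_notP no => /eqP uv2; exists u, v.
pose h (j : J) := if j.2 == 2 then p j else 0.
have [|s1 [s2 hE]] := rig h.
  move=> i; rewrite rig_row_sum; case: i => [u|[u v]]; rewrite ?sum3 /h /=.
    by ring.
  by case: (boolP (e u v)) => [/flat ->|_] /=; ring.
move: nd; rewrite /nondeg mulf_eq0 negb_or => /andP[_] /eqP[].
have := hE (b, 2); have := hE (a, 2); rewrite /h /rotation /translation /= => -> ->.
by rewrite !mulr0 subrr.
Qed.

Lemma good_generic_rigid (p q : J -> R) : symmetric e -> good e e p ->
  (forall P : {mpoly rat[#|{: J}|]}, P != 0 -> evp p P != 0) ->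
  (forall i, measurement q i = measurement p i) ->
  forall u v, \sum_k (q (u, k) - q (v, k)) ^+ 2 = \sum_k (p (u, k) - p (v, k)) ^+ 2.
Proof.
move=> e_sym [[x [y [z nd]]] rig [w [l [st _ [ker1 ker0]]]]] gen eqm.
have [_ _ st_eq] := stress_transfer e_sym gen eqm st.
have [a [b qx]] := ker1 _ (st_eq 0).
have [c [d qy]] := ker1 _ (st_eq 1).
have [f [g qz]] := ker0 _ (st_eq 2).
(* Equality of the radii is the vanishing of one quadratic form at all vertices; hence the planar
   matrix with rows [a], [b] and [c], [d] is orthogonal. *)
have [/eqP A0 B0 /eqP C0] : [/\ a ^+ 2 + c ^+ 2 - 1 = 0, 2 * (a * b + c * d) = 0
    & b ^+ 2 + d ^+ 2 - 1 = 0].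
  apply: (quadratic_form_eq0 nd) => u.
  have := eqm (inl u); rewrite /= qx qy => /eqP; rewrite -subr_eq0 => /eqP E.
  by rewrite -[RHS]E; ring.
rewrite subr_eq0 in A0; rewrite subr_eq0 in C0.
have planeE u v : (q (u, 0) - q (v, 0)) ^+ 2 + (q (u, 1) - q (v, 1)) ^+ 2 =
    (p (u, 0) - p (v, 0)) ^+ 2 + (p (u, 1) - p (v, 1)) ^+ 2.
  rewrite !qx !qy.
  transitivity ((a ^+ 2 + c ^+ 2) * (p (u, 0) - p (v, 0)) ^+ 2 +
    2 * (a * b + c * d) * ((p (u, 0) - p (v, 0)) * (p (u, 1) - p (v, 1))) +
    (b ^+ 2 + d ^+ 2) * (p (u, 1) - p (v, 1)) ^+ 2); first by ring.
  by rewrite B0 (eqP A0) (eqP C0); ring.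
have [u0 [v0 [uv0 z0]]] := rigid_edge nd rig.
(* The planar part being isometric, an edge with distinct heights fixes the scale along the axis up
   to sign. *)
have g1 : g ^+ 2 = 1.
  have := eqm (inr (u0, v0)); rewrite /= uv0 !mul1r !sum3 planeE => /addrI.
  rewrite !qz => E; apply: (@mulIf _ ((p (u0, 2) - p (v0, 2)) ^+ 2)).
    by rewrite expf_neq0 // subr_eq0.
  by rewrite mul1r -[RHS]E; ring.
move=> u v; rewrite !sum3 planeE; congr (_ + _); rewrite !qz.
transitivity (g ^+ 2 * (p (u, 2) - p (v, 2)) ^+ 2); first by ring.
by rewrite g1 mul1r.
Qed.

End Transfer.

(** The polynomial [D] of [good_open] is nonzero, as it does not vanish at [t0]; having rational
    coefficients, it cannot vanish at a generic [p]. *)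
Lemma generic_rigid_of_good (R : realType) (G : sgraph) (t0 : G * 'I_3 -> rat) :
  good (@adj G) (@adj G) t0 ->
  forall p : G -> 'rV[R]_3, generic p -> globally_rigid p.
Proof.
move=> gt0 p gen q qcyl qdist u v.
pose P (j : G * 'I_3) := p j.1 0 j.2.
pose Q (j : G * 'I_3) := q j.1 0 j.2.
have genP (F : {mpoly rat[#|{: G * 'I_3}|]}) : F != 0 -> evp P F != 0 by exact: gen.
have [D D0 DP] := good_open (@adj_sym G) gt0.
have goodP : good (@adj G) (@adj G) P.
  apply: DP; apply: genP; apply: contraNneq D0 => ->; by rewrite rmorph0.
have sq_ge0 (s : G -> 'rV[R]_3) x y : 0 <= \sum_(k < 3) (s x 0 k - s y 0 k) ^+ 2.
  by apply: sumr_ge0 => k _; rewrite sqr_ge0.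
congr Num.sqrt.
apply: (good_generic_rigid (p := P) (q := Q) (@adj_sym G) goodP genP).
case=> [x|[x y]] /=; first exact: qcyl.
case: (boolP (adj x y)) => [xy|_]; last by rewrite !mul0r.
rewrite !mul1r.
have := qdist _ _ xy; rewrite /edist => /(congr1 (fun s => s ^+ 2)).
by rewrite !sqr_sqrtr.
Qed.

(** * The base graphs *)

Local Notation fs := (lift ord0).
Local Notation v0 := ord0.
Local Notation v1 := (fs v0).
Local Notation v2 := (fs v1).
Local Notation v3 := (fs v2).
Local Notation v4 := (fs v3).
Local Notation v5 := (fs v4).
Local Notation v6 := (fs v5).

(** Splits a statement over an ordinal type into closed cases built from [ord0] and [lift], the
    shape that [big_ord_recl] produces and on which the tables compute. *)
Lemma all_ordS (n : nat) (P : 'I_n.+1 -> Prop) :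
  P v0 -> (forall i, P (fs i)) -> forall i, P i.
Proof. by move=> P0 PS i; case: (unliftP v0 i) => [j ->|->]. Qed.

Lemma all_ord3 (P : 'I_3 -> Prop) : P 0 -> P 1 -> P 2 -> forall k, P k.
Proof. by move=> P0 P1 P2 k; case: (ord3P k) => ->. Qed.

Ltac all_ord := repeat (apply: all_ordS); try by case.

(* The configurations and the stresses in the tables below were found by a
   computer search over small integers. *)
Definition coord_table (n : nat) (s : seq (seq rat)) (j : 'I_n * 'I_3) : rat :=
  nth 0 (nth [::] s j.1) j.2.

Definition weight_table (n : nat) (s : seq (seq rat)) (u v : 'I_n) : rat :=
  nth 0 (nth [::] s u) v.

Definition radial_table (n : nat) (s : seq rat) (u : 'I_n) : rat := nth 0 s u.

Lemma rig_ker_equations (K : fieldType) (V : finType) (e : rel V)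
    (t h : V * 'I_3 -> K) : in_ker (rig_row e t) h ->
  (forall u, t (u, 0) * h (u, 0) + t (u, 1) * h (u, 1) = 0) /\
  (forall u v, e u v -> (t (u, 0) - t (v, 0)) * (h (u, 0) - h (v, 0)) +
     (t (u, 1) - t (v, 1)) * (h (u, 1) - h (v, 1)) +
     (t (u, 2) - t (v, 2)) * (h (u, 2) - h (v, 2)) = 0).
Proof.
move=> hk; split=> [u|u v uv]; first by have := hk (inl u); rewrite rig_row_sum.
by have := hk (inr (u, v)); rewrite rig_row_sum uv mul1r sum3.
Qed.

Lemma K5_minus_edge_adj (u v : K5_minus_edge) :
  @adj K5_minus_edge u v = (u != v) && ((u, v) \notin [:: (0, 1); (1, 0)]).
Proof. by rewrite /adj /= /delete_edge_rel set2_eq. Qed.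

Lemma K5_minus_edge_good : exists t : K5_minus_edge * 'I_3 -> rat,
  good (@adj K5_minus_edge) (@adj K5_minus_edge) t.
Proof.
(* Adjacency restated without equality of sets, so that it computes. *)
pose e (u v : 'I_5) := (u != v) && ((u, v) \notin [:: (0, 1); (1, 0)]).
suff: exists t : 'I_5 * 'I_3 -> rat, good e e t.
  move=> [t gt]; exists t; move: gt; congr (good _ _ t);
  by apply/funext => u; apply/funext => v; rewrite K5_minus_edge_adj.
pose t : 'I_5 * 'I_3 -> rat := coord_table
  [:: [:: 0; -1; 1]; [:: 1; 0; 1]; [:: 0; -1; 0]; [:: 1; 0; 0]; [:: 1; 1; -1]].
pose w : 'I_5 -> 'I_5 -> rat := weight_table
  [:: [:: 0; 0; 1; 1; -1];
      [:: 0; 0; 1; -3; 1];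
      [:: 1; 1; 0; -3; 2];
      [:: 1; -3; -3; 0; -2];
      [:: -1; 1; 2; -2; 0]].
pose l : 'I_5 -> rat := radial_table [:: 1; -1; -2; 2; -1].
exists t; split.
- by exists v0, v3, v4.
- move=> h /rig_ker_equations[cyl edge].
  (* At [v3], placed at (1, 0, 0), the rotation has y-component 1 and the translation 0; the
     z-component at [v0] sees only the translation. *)
  exists (h (v3, 1)), (h (v0, 2)) => -[u k].
  move: (cyl v0) (cyl v1) (cyl v2) (cyl v3) (cyl v4)
    (edge v0 v2 isT) (edge v0 v3 isT) (edge v0 v4 isT) (edge v1 v2 isT)
    (edge v1 v3 isT) (edge v1 v4 isT) (edge v2 v3 isT) (edge v2 v4 isT)
    (edge v3 v4 isT).
  rewrite /t /rotation /translation /coord_table /= {cyl edge} => *.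
  by move: k; apply: all_ord3; move: u; all_ord; rewrite /=; lra.
have stress_eq bb h : in_ker (stress_mx bb w l) h -> forall u,
    \sum_v w u v * (h u - h v) + bb%:R * l u * h u = 0.
  by move=> hk u; rewrite -stress_mx_sum.
exists w, l; split; first split.
- by all_ord.
- suff E : forall u v, ~~ e u v ==> (w u v == 0).
    by move=> u v /(implyP (E u v))/eqP.
  by all_ord.
- move=> k u; rewrite stress_mx_sum !big_ord_recl big_ord0.
  by move: k; apply: all_ord3; move: u; all_ord;
    rewrite /t /w /l /coord_table /weight_table /radial_table /planar /=; ring.
- suff E : forall u v, e u v ==> (w u v != 0) by move=> u v /(implyP (E u v)).
  by all_ord.
split=> h /stress_eq hk.
  (* [v3] and [v0] project to (1, 0) and (0, -1), where the values of a linear form give its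
     coefficients. *)
  exists (h v3), (- h v0) => u.
  move: (hk v0) (hk v1) (hk v2) (hk v3) (hk v4).
  rewrite !big_ord_recl !big_ord0.
  rewrite /t /w /l /coord_table /weight_table /radial_table /= {hk} => *.
  by move: u; all_ord; rewrite /=; lra.
(* [v2] and [v0] have heights 0 and 1. *)
exists (h v2), (h v0 - h v2) => u.
move: (hk v0) (hk v1) (hk v2) (hk v3) (hk v4).
rewrite !big_ord_recl !big_ord0.
rewrite /t /w /l /coord_table /weight_table /radial_table /= {hk} => *.
by move: u; all_ord; rewrite /=; lra.
Qed.

Lemma H1_good : exists t : H1 * 'I_3 -> rat,
  good (@adj H1) (@adj H1) t.
Proof.
pose e : rel 'I_6 := @adj H1.
pose t : 'I_6 * 'I_3 -> rat := coord_table
  [:: [:: -1; 1; 0]; [:: -1; 0; 0]; [:: -1; 0; -1]; [:: 1; 1; 1];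
      [:: 0; 1; 1]; [:: 1; 1; 0]].
pose w : 'I_6 -> 'I_6 -> rat := weight_table
  [:: [:: 0; -1; 0; -1; 1; 0];
      [:: -1; 0; -1; 1; -2; 2];
      [:: 0; -1; 0; 0; 1; -1];
      [:: -1; 1; 0; 0; 1; 0];
      [:: 1; -2; 1; 1; 0; -1];
      [:: 0; 2; -1; 0; -1; 0]].
pose l : 'I_6 -> rat := radial_table [:: 1; -4; 1; -1; 1; -1].
exists t; split.
- by exists v0, v2, v3.
- move=> h /rig_ker_equations[cyl edge].
  pose triv u := forall k,
    h (u, k) = - h (v4, 0) * rotation t (u, k) + h (v0, 2) * translation _ (u, k).
  (* The first copy of the complete graph has only trivial motions by itself; the second then
     inherits its motion from the shared edge [v1], [v4]. *)
  have [T0 T1 T3 T4] : [/\ triv v0, triv v1, triv v3 & triv v4].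
    move: (cyl v0) (cyl v1) (cyl v3) (cyl v4)
      (edge v0 v1 isT) (edge v0 v3 isT) (edge v0 v4 isT) (edge v1 v3 isT)
      (edge v1 v4 isT) (edge v3 v4 isT).
    rewrite /triv /t /rotation /translation /coord_table /= {cyl edge} => *.
    by split; apply: all_ord3; rewrite /=; lra.
  have [T2 T5] : [/\ triv v2 & triv v5].
    move: (cyl v2) (cyl v5)
      (edge v1 v2 isT) (edge v1 v5 isT) (edge v2 v4 isT) (edge v2 v5 isT)
      (edge v4 v5 isT)
      (T1 0) (T1 1) (T1 2) (T4 0) (T4 1) (T4 2).
    rewrite /triv /t /rotation /translation /coord_table /= {cyl edge T0 T1 T3 T4}.
    move=> *.
    by split; apply: all_ord3; rewrite /=; lra.
  exists (- h (v4, 0)), (h (v0, 2)) => -[u k].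
  by move: u; all_ord; [exact: T0|exact: T1|exact: T2|exact: T3|exact: T4|exact: T5].
have stress_eq bb h : in_ker (stress_mx bb w l) h -> forall u,
    \sum_v w u v * (h u - h v) + bb%:R * l u * h u = 0.
  by move=> hk u; rewrite -stress_mx_sum.
exists w, l; split; first split.
- by all_ord.
- suff E : forall u v, ~~ e u v ==> (w u v == 0).
    by move=> u v /(implyP (E u v))/eqP.
  by all_ord.
- move=> k u; rewrite stress_mx_sum !big_ord_recl big_ord0.
  by move: k; apply: all_ord3; move: u; all_ord;
    rewrite /t /w /l /coord_table /weight_table /radial_table /planar /=; ring.
- suff E : forall u v, e u v ==> (w u v != 0) by move=> u v /(implyP (E u v)).
  by all_ord.
split=> h /stress_eq hk.
  exists (- h v1), (h v4) => u.
  move: (hk v0) (hk v1) (hk v2) (hk v3) (hk v4) (hk v5).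
  rewrite !big_ord_recl !big_ord0.
  rewrite /t /w /l /coord_table /weight_table /radial_table /= {hk} => *.
  by move: u; all_ord; rewrite /=; lra.
exists (h v0), (h v3 - h v0) => u.
move: (hk v0) (hk v1) (hk v2) (hk v3) (hk v4) (hk v5).
rewrite !big_ord_recl !big_ord0.
rewrite /t /w /l /coord_table /weight_table /radial_table /= {hk} => *.
by move: u; all_ord; rewrite /=; lra.
Qed.

Lemma H2_good : exists t : H2 * 'I_3 -> rat,
  good (@adj H2) (@adj H2) t.
Proof.
pose e : rel 'I_7 := @adj H2.
pose t : 'I_7 * 'I_3 -> rat := coord_table
  [:: [:: 0; -1; 0]; [:: -1; 0; 0]; [:: -1; -1; 0]; [:: -1; -1; 1];
      [:: -1; 0; -1]; [:: -1; 1; -1]; [:: 1; 0; 0]].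
pose w : 'I_7 -> 'I_7 -> rat := weight_table
  [:: [:: 0; -4; 0; 2; 2; 0; 0];
      [:: -4; 0; -2; 6; 6; 0; 0];
      [:: 0; -2; 0; 0; -1; 1; -1];
      [:: 2; 6; 0; 0; -4; 0; 0];
      [:: 2; 6; -1; -4; 0; -3; 1];
      [:: 0; 0; 1; 0; -3; 0; -1];
      [:: 0; 0; -1; 0; 1; -1; 0]].
pose l : 'I_7 -> rat := radial_table [:: 2; 4; 2; -2; -4; 2; 2].
exists t; split.
- by exists v0, v3, v1.
- move=> h /rig_ker_equations[cyl edge].
  pose triv u := forall k,
    h (u, k) = h (v0, 0) * rotation t (u, k) + h (v0, 2) * translation _ (u, k).
  have [T0 T1 T3 T4] : [/\ triv v0, triv v1, triv v3 & triv v4].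
    move: (cyl v0) (cyl v1) (cyl v3) (cyl v4)
      (edge v0 v1 isT) (edge v0 v3 isT) (edge v0 v4 isT) (edge v1 v3 isT)
      (edge v1 v4 isT) (edge v3 v4 isT).
    rewrite /triv /t /rotation /translation /coord_table /= {cyl edge} => *.
    by split; apply: all_ord3; rewrite /=; lra.
  (* The second copy is pinned by the shared vertex [v4] and the joining edge from [v1] to [v2]. *)
  have [T2 T5 T6] : [/\ triv v2, triv v5 & triv v6].
    move: (cyl v2) (cyl v5) (cyl v6)
      (edge v2 v4 isT) (edge v2 v5 isT) (edge v2 v6 isT) (edge v4 v5 isT)
      (edge v4 v6 isT) (edge v5 v6 isT) (edge v1 v2 isT)
      (T1 0) (T1 1) (T1 2) (T4 0) (T4 1) (T4 2).
    rewrite /triv /t /rotation /translation /coord_table /= {cyl edge T0 T1 T3 T4}.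
    move=> *.
    by split; apply: all_ord3; rewrite /=; lra.
  exists (h (v0, 0)), (h (v0, 2)) => -[u k].
  by move: u; all_ord;
    [exact: T0|exact: T1|exact: T2|exact: T3|exact: T4|exact: T5|exact: T6].
have stress_eq bb h : in_ker (stress_mx bb w l) h -> forall u,
    \sum_v w u v * (h u - h v) + bb%:R * l u * h u = 0.
  by move=> hk u; rewrite -stress_mx_sum.
exists w, l; split; first split.
- by all_ord.
- suff E : forall u v, ~~ e u v ==> (w u v == 0).
    by move=> u v /(implyP (E u v))/eqP.
  by all_ord.
- move=> k u; rewrite stress_mx_sum !big_ord_recl big_ord0.
  by move: k; apply: all_ord3; move: u; all_ord;
    rewrite /t /w /l /coord_table /weight_table /radial_table /planar /=; ring.
- suff E : forall u v, e u v ==> (w u v != 0) by move=> u v /(implyP (E u v)).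
  by all_ord.
split=> h /stress_eq hk.
  exists (h v6), (- h v0) => u.
  move: (hk v0) (hk v1) (hk v2) (hk v3) (hk v4) (hk v5) (hk v6).
  rewrite !big_ord_recl !big_ord0.
  rewrite /t /w /l /coord_table /weight_table /radial_table /= {hk} => *.
  by move: u; all_ord; rewrite /=; lra.
exists (h v0), (h v3 - h v0) => u.
move: (hk v0) (hk v1) (hk v2) (hk v3) (hk v4) (hk v5) (hk v6).
rewrite !big_ord_recl !big_ord0.
rewrite /t /w /l /coord_table /weight_table /radial_table /= {hk} => *.
by move: u; all_ord; rewrite /=; lra.
Qed.

Lemma constructible_good (G : sgraph) : constructible G ->
  exists t : G * 'I_3 -> rat, good (@adj G) (@adj G) t.
Proof.
elim=> [|||{}G a b ab nab _ [t gt]|{}G a b c ab ca cb _ [t gt]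
  |{}G H [f bij_f ef] _ [t gt]].
- exact: K5_minus_edge_good.
- exact: H1_good.
- exact: H2_good.
- exists t; have := good_add_edge (@adj_sym G) ab nab gt.
  (* The guard [u != v] of [add_edge_rel] agrees with the list form because [a] and [b] are
     distinct. *)
  congr (good _ _ t); apply/funext => u; apply/funext => v;
    rewrite /adj /= /add_edge_rel set2_eq;
    case: (eqVneq u v) => [->|//]; rewrite /= !inE !xpair_eqE;
    case: (eqVneq v a) => [->|_] //=; rewrite ?(negPf ab) ?andbF //.
- exact: good_one_extension gt.
have [g fK gK] := bij_f.
exists (fun j => t (g j.1, j.2)); apply: (good_iso bij_f ef).
by congr (good _ _ _): gt; apply/funext => -[u k] /=; rewrite fK.
Qed.

Theorem theorem7p3 (R : realType) (n : nat) (G : sgraph) :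
  #|G| = n -> constructible G ->
  forall p : G -> 'rV[R]_3, generic p -> globally_rigid p.
Proof. by move=> _ /constructible_good[t gt]; exact: generic_rigid_of_good gt. Qed.
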